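(* Let $n\ge 2$ and $\mathfrak n\ge 1$ be integers and let $\mathbf s=\{s_{i_1,\dots,i_n}\}_{i_1,\dots,i_n=0}^{2\mathfrak n-1}$ be real numbers. For $J=(j_2,\dots,j_n)\in\{0,\dots,2\mathfrak n-1\}^{n-1}$ let $\mathfrak s_J=\{\mathfrak s_{i,j_2,\dots,j_n}\}_{i=0}^{2\mathfrak n-1}$ be the associated sequence. Suppose that for every $J$ the number $\mathfrak n$ is a normal index of $\mathfrak s_J$ and $\mathfrak s_J$ is regular. Let $n_1^{J}<\dots<n_{N_J}^{J}=\mathfrak n$ be the normal indices of $\mathfrak s_J$, and let $m_k^{J},l_k^{J}$ be its S-fraction atoms and $P^{+J}_{k},Q^{+J}_{k}$ its Stieltjes polynomials of the first and second kind (all defined in the context). Then any solution $F$ of the problem $\mathbf{MP}(\mathbf s,2\mathfrak n-1)$ has the representation $$F(z_1,\dots,z_n)=\sum_{j_2,\dots,j_n=0}^{2\mathfrak n-1}\frac{1}{\prod_{i=2}^n z_i^{j_i+1}}\cdot\cfrac{1}{-z_1m_1^{J}(z_1)+\cfrac{1}{l_1^{J}+\cdots+\cfrac{1}{-z_1m_{N_J}^{J}(z_1)+\cfrac{1}{l_{N_J}^{J}+\tau_J(z_1)}}}},$$ where the parameters $\tau_J$ satisfy $\tau_J(z_1)=o(1)$ as $z_1\widehat{\rightarrow}\infty$. Furthermore, this representation can be rewritten as $$F(z_1,\dots,z_n)=\sum_{j_2,\dots,j_n=0}^{2\mathfrak n-1}\frac{1}{\prod_{i=2}^n z_i^{j_i+1}}\;\frac{Q^{+J}_{2N_J-1}(z_1)\,\tau_J(z_1)+Q^{+J}_{2N_J}(z_1)}{P^{+J}_{2N_J-1}(z_1)\,\tau_J(z_1)+P^{+J}_{2N_J}(z_1)}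 .$$
   Context: **Limits.** A Stolz domain with centre $0$ and angle $\theta\in(0,\pi/2]$ is $\{z\in\mathbb C^+:\theta<\arg z<\pi-\theta\}$; $z\widehat{\rightarrow}\infty$ means $|z|\to\infty$ inside any such Stolz domain. Identities between functions of $z_1$ are understood for $z_1$ in any such Stolz domain with $|z_1|$ sufficiently large (depending on the domain), and $z_2,\dots,z_n\neq0$. **Associated sequences.** For $J=(j_2,\dots,j_n)$, $$\mathfrak s_{i,j_2,\dots,j_n}=\binom{i+j_2+\dots+j_n}{i,j_2,\dots,j_n}s_{i,j_2,\dots,j_n}\quad(\text{multinomial coefficient}).$$ **The problem $\mathbf{MP}(\mathbf s,\ell)$.** Given real numbers $\mathbf s=\{s_{i_1,\dots,i_n}\}_{i_1,\dots,i_n=0}^{\ell}$, a solution is a function of the form $$F(z_1,\dots,z_n)=\sum_{j_2,\dots,j_n=0}^{\ell}\frac{F_{j_2,\dots,j_n}(z_1)}{z_2^{j_2+1}\cdots z_n^{j_n+1}},$$ where each $F_{J}$ is a complex function on $\mathbb C^+$ with $$F_J(z_1)=-\frac{\mathfrak s_{0,j_2,\dots,j_n}}{z_1}-\dots-\frac{\mathfrak s_{\ell,j_2,\dots,j_n}}{z_1^{\ell+1}}+o\left(\frac1{z_1^{\ell+1}}\right),\quad z_1\widehat{\rightarrow}\infty .$$ **Objects attached to a one-dimensional real sequence** $c=\{c_i\}_{i=0}^{2\mathfrak n-1}$ (applied to $c=\mathfrak s_J$, the superscript $J$ indicating the sequence). *Normal indices:* the integers $m$, $1\le m\le\mathfrak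 n$, with $D_m:=\det(c_{p+q})_{p,q=0}^{m-1}\ne0$. List them as $n_1<\dots<n_N$; assume $n_N=\mathfrak n$; put $n_0=0$ and $\nu_k=n_k-n_{k-1}$. *P-fraction atoms:* Put $c^{(0)}_i=c_i$. For $k=1,\dots,N-1$ and $0\le i\le 2\mathfrak n-2n_k-1$, $$c^{(k)}_i=\frac{(-1)^{i+\nu_k}}{\big(c^{(k-1)}_{\nu_k-1}\big)^{i+\nu_k+1}}\det(T_{pq})_{p,q=1}^{i+\nu_k+1},\qquad T_{pq}=\begin{cases}c^{(k-1)}_{\nu_k+p-q},&q\le p+1,\\0,&q>p+1.\end{cases}$$ For $k=0,\dots,N-1$, with $\nu=\nu_{k+1}$ and $D^{(k)}_\nu=\det(c^{(k)}_{p+q})_{p,q=0}^{\nu-1}$, $$b_k=c^{(k)}_{\nu-1},\qquad a_k(z)=\frac1{D^{(k)}_\nu}\begin{vmatrix}c^{(k)}_0&c^{(k)}_1&\dots&c^{(k)}_\nu\\ \vdots&\vdots&&\vdots\\ c^{(k)}_{\nu-1}&c^{(k)}_\nu&\dots&c^{(k)}_{2\nu-1}\\1&z&\dots&z^\nu\end{vmatrix}.$$ *Polynomials of the first kind:* $P_{n_k}$ ($-1\le k\le N$) is the solution of $b_k y_{n_{k-1}}(z)-a_k(z)y_{n_k}(z)+y_{n_{k+1}}(z)=0$, $k=0,\dots,N-1$, with $P_{n_{-1}}\equiv0$, $P_{n_0}\equiv1$. *Regularity:* $c$ is regular if $P_{n_j}(0)\neq0$ for every $1\le j\le N$ (equivalently,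 $D^+_{n_j}\ne0$ for all such $j$, where $D^+_m=\det(c_{p+q+1})_{p,q=0}^{m-1}$). *S-fraction atoms:* $$d_1=\frac1{b_0},\qquad l_1=-\frac1{d_1a_0(0)},\qquad d_j=\frac1{b_{j-1}\,l_{j-1}^2\,d_{j-1}},\qquad l_j=-\frac{l_{j-1}}{1+l_{j-1}d_ja_{j-1}(0)},$$ $$m_j(z)=\frac{(a_{j-1}(z)-a_{j-1}(0))\,d_j}{z},\qquad 1\le j\le N;$$ $d_j$ is the leading coefficient of $m_j$. *Stieltjes polynomials:* $P^+_k$ and $Q^+_k$ ($-1\le k\le 2N$) are the solutions of $$y_{2j}-y_{2j-2}=l_j\,y_{2j-1},\qquad y_{2j+1}-y_{2j-1}=-z\,m_{j+1}(z)\,y_{2j}$$ with $P^+_{-1}\equiv0$, $P^+_0\equiv1$, $Q^+_{-1}\equiv1$, $Q^+_0\equiv0$. *)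

(* Defs.v *)
From mathcomp Require Import all_boot all_order all_algebra.
From mathcomp Require Import complex.
From mathcomp Require Import all_classical all_reals all_analysis.

Set Implicit Arguments.
Unset Strict Implicit.
Unset Printing Implicit Defensive.

Import Order.TTheory GRing.Theory Num.Theory.
Import numFieldNormedType.Exports.

Local Open Scope classical_set_scope.
Local Open Scope ring_scope.
Local Open Scope complex_scope.

Section StolzDomain.
Variable R : realType.

Definition stolz (theta : R) : set R[i] :=
  [set z | exists r phi : R,
     [/\ 0 < r, theta < phi < pi - theta & z = (r * cos phi) +i* (r * sin phi)]].

(* Improper for theta = pi / 2, where the Stolz domain is empty. *)
Definition stolz_infty (theta : R) : set_system R[i] :=
  [set A | exists M : R, forall z, stolz theta z -> M%:C < `|z| -> A z].

Global Instance stolz_infty_filter theta : Filter (stolz_infty theta).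
Proof.
split.
- by exists 0.
- move=> A B [M hM] [N hN]; exists (Num.max M N) => z hz.
  rewrite -/(real_complex R _) => lt_z; split; [apply: hM | apply: hN] => //;
    by apply: le_lt_trans lt_z; rewrite lecR le_max lexx ?orbT.
- by move=> A B AB [M hM]; exists M => z hz /(hM z hz) /AB.
Qed.

Canonical stolz_infty_filter_on theta := FilterType (stolz_infty theta) _.

Definition stolz_angle : set R := [set theta | 0 < theta <= pi / 2].

(* f = o(g) as z tends to infinity nontangentially. *)
Definition stolz_littleo (f g : R[i] -> R[i]) : Prop :=
  forall theta, stolz_angle theta ->
    (f : R[i] -> R[i]^o) =o_ (stolz_infty theta) (g : R[i] -> R[i]^o).

End StolzDomain.

(* The multi-indices (j_2, ..., j_n) with entries in {0, ..., ell}; the entry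
   with index k : 'I_n.-1 is j_(k + 2). *)
Notation multi_index n ell := {ffun 'I_n.-1 -> 'I_ell.+1}.

Section MomentProblem.
Variables (R : realType) (n ell : nat).
Variable s : 'I_ell.+1 -> multi_index n ell -> R.

Definition multinomial_coef (i : nat) (J : multi_index n ell) : nat :=
  ((i + \sum_k J k)`! %/ (i`! * \prod_k (J k)`!))%N.

(* Only the values at i <= ell are meaningful. *)
Definition associated_seq (J : multi_index n ell) (i : nat) : R :=
  (multinomial_coef i J)%:R * s (inord i) J.

(* The product z_2^(j_2 + 1) ... z_n^(j_n + 1). *)
Definition monomial (J : multi_index n ell) (z' : {ffun 'I_n.-1 -> R[i]}) : R[i] :=
  \prod_k z' k ^+ (J k).+1.

(* A function of (z_1, ..., z_n) takes z_1 and z' = (z_2, ..., z_n). *)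
Definition MP_solution (F : R[i] -> {ffun 'I_n.-1 -> R[i]} -> R[i]) : Prop :=
  exists f : multi_index n ell -> R[i] -> R[i],
    (forall (z1 : R[i]) (z' : {ffun 'I_n.-1 -> R[i]}),
       0 < complex.Im z1 -> (forall k, z' k != 0) ->
       F z1 z' = \sum_J f J z1 / monomial J z') /\
    (forall J, stolz_littleo
       (fun z => f J z - (- \sum_(i < ell.+1) (associated_seq J i)%:C / z ^+ i.+1))
       (fun z => 1 / z ^+ ell.+1)).

End MomentProblem.

(* Below, c stands for a sequence c_0, ..., c_(2 nf - 1), extended arbitrarily
   to a function on nat. *)
Section SequenceObjects.
Variables (R : realType) (nf : nat) (c : nat -> R).

Definition hankel_det (c : nat -> R) (m : nat) : R :=
  \det (\matrix_(p < m, q < m) c (p + q)%N).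

Definition normal_indices : seq nat :=
  [seq m <- iota 1 nf | hankel_det c m != 0].

Definition normal_count : nat := size normal_indices.

Definition normal_index (k : nat) : nat := nth 0%N (0%N :: normal_indices) k.

Definition nu (k : nat) : nat := (normal_index k - normal_index k.-1)%N.

(* The matrix T, with p and q numbered from 0. *)
Definition toeplitz_det (c : nat -> R) (v m : nat) : R :=
  \det (\matrix_(p < m, q < m)
          if (q <= p.+1)%N then c (v + p - q)%N else 0).

(* The sequence c^(k). *)
Fixpoint pseq (k i : nat) : R :=
  if k is k'.+1 then
    (-1) ^+ (i + nu k) / pseq k' (nu k).-1 ^+ (i + nu k).+1
      * toeplitz_det (pseq k') (nu k) (i + nu k).+1
  else c i.

Definition b (k : nat) : R := pseq k (nu k.+1).-1.

Definition a (k : nat) : {poly R} :=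
  let v := nu k.+1 in
  (hankel_det (pseq k) v)^-1 *:
    \det (\matrix_(p < v.+1, q < v.+1)
            if (p < v)%N then (pseq k (p + q)%N)%:P else 'X^q).

(* The pair (P_(n_(k-1)), P_(n_k)). *)
Fixpoint first_kind_pair (k : nat) : {poly R} * {poly R} :=
  if k is k'.+1 then
    let: (y0, y1) := first_kind_pair k' in (y1, a k' * y1 - b k' *: y0)
  else (0, 1).

Definition first_kind (k : nat) : {poly R} := (first_kind_pair k).2.

Definition regular : Prop :=
  forall j, (1 <= j <= normal_count)%N -> (first_kind j).[0] != 0.

(* The pair (d_(k+1), l_(k+1)). *)
Fixpoint dl (k : nat) : R * R :=
  if k is k'.+1 then
    let: (d, l) := dl k' in
    let d' := 1 / (b k * l ^+ 2 * d) in
    (d', - (l / (1 + l * d' * (a k).[0])))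
  else
    let d1 := 1 / b 0 in (d1, - (1 / (d1 * (a 0).[0]))).

Definition d_atom (j : nat) : R := (dl j.-1).1.
Definition l_atom (j : nat) : R := (dl j.-1).2.

(* The division by 'X is exact. *)
Definition m_atom (j : nat) : {poly R} :=
  (d_atom j *: (a j.-1 - (a j.-1).[0]%:P)) %/ 'X.

(* The pair (y_(k-1), y_k), for the solution starting at (y_(-1), y_0) = (u, v);
   both recurrences lead from k = 2j and k = 2j + 1 to atoms of index j + 1. *)
Fixpoint stieltjes_pair (u v : {poly R}) (k : nat) : {poly R} * {poly R} :=
  if k is k'.+1 then
    let: (y0, y1) := stieltjes_pair u v k' in
    let j := k'./2.+1 in
    (y1, if odd k' then y0 + l_atom j *: y1 else y0 - 'X * m_atom j * y1)
  else (u, v).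

Definition Pplus (k : nat) : {poly R} := (stieltjes_pair 0 1 k).2.
Definition Qplus (k : nat) : {poly R} := (stieltjes_pair 1 0 k).2.

Definition evalC (p : {poly R}) (z : R[i]) : R[i] :=
  (map_poly (real_complex R) p).[z].

(* The part of the continued fraction that is added to l_j:
   1/(- z m_(j+1)(z) + 1/(l_(j+1) + ... + 1/(l_N + t))), equal to t for j = N. *)
Definition Sfrac_tail (z t : R[i]) (j : nat) : R[i] :=
  foldr (fun k x => 1 / (- (z * evalC (m_atom k) z) + 1 / ((l_atom k)%:C + x)))
        t (iota j.+1 (normal_count - j)).

Definition Sfrac (z t : R[i]) : R[i] := Sfrac_tail z t 0.

(* Division by 0 being total, this says that every denominator in
   Sfrac z t is nonzero. *)
Definition Sfrac_defined (z t : R[i]) : Prop :=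
  forall j, (1 <= j <= normal_count)%N ->
    (l_atom j)%:C + Sfrac_tail z t j != 0 /\
    - (z * evalC (m_atom j) z) + 1 / ((l_atom j)%:C + Sfrac_tail z t j) != 0.

Definition mobius_num (z t : R[i]) : R[i] :=
  evalC (Qplus (2 * normal_count).-1) z * t + evalC (Qplus (2 * normal_count)) z.

Definition mobius_den (z t : R[i]) : R[i] :=
  evalC (Pplus (2 * normal_count).-1) z * t + evalC (Pplus (2 * normal_count)) z.

End SequenceObjects.

(* Main.v *)
Require Import Defs.
From mathcomp Require Import all_boot all_order all_algebra.
From mathcomp Require Import complex.
From mathcomp Require Import all_classical all_reals all_analysis.
From mathcomp Require Import ring zify.

Set Implicit Arguments.
Unset Strict Implicit.
Unset Printing Implicit Defensive.

Import Order.TTheory GRing.Theory Num.Theory.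
Import numFieldNormedType.Exports.

Local Open Scope classical_set_scope.
Local Open Scope ring_scope.
Local Open Scope complex_scope.

(** A solution of the moment problem is a finite sum, over the multi-indices J, of
    functions f_J(z_1) whose asymptotic expansions are prescribed by the associated
    sequences, so the theorem reduces to one sequence c and one function
    f = S + o(z^(-2 nf)), where S = - c_0 / z - c_1 / z^2 - ....

    The algebraic half identifies the convergents of S. The determinants that define
    the atoms are coefficients of a reciprocal power series ([toeplitz_det_recip],
    [hankel_bordered_det_recip]), so they perform one step S = - b / (a + S') of a
    continued fraction ([continued_fraction_step]). Replacing S by - A / z^M, with
    M = 2 nf and A the polynomial c_0 z^(M-1) + ... + c_(M-1), turns the whole
    expansion into a Euclidean algorithm on z^M and A, in which orders at infinity
    are degrees of polynomials. Its remainders r_k = A P_k + z^M Q_k, k < N, have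
    degrees M - n_(k+1): a denominator P_k with remainder of order e gives kernel vectors of
    the Hankel matrices strictly between its degree and e, and coprimality excludes
    one of order e ([hankel_det_convergent]). An induction on k ([pfrac_invP]) keeps
    track of this and shows that the last remainder has degree less than nf. The
    Stieltjes polynomials of even index are nonzero multiples of the P_k and Q_k
    ([stieltjes_pfrac]); regularity keeps the denominators of the atoms l_j
    nonzero. Writing P+ and Q+ for the Stieltjes polynomials, it follows that P+_(2N) has degree nf, that f P+_(2N) - Q+_(2N)
    is o(z^(-nf)), and that P+_(2N) Q+_(2N-1) - P+_(2N-1) Q+_(2N) = 1.

    The analytic half takes for tau the solution of the Moebius equation,
    tau = (Q+_(2N) - f P+_(2N)) / (f P+_(2N-1) - Q+_(2N-1)). By the determinant
    relation, P+_(2N) (f P+_(2N-1) - Q+_(2N-1)) =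
    P+_(2N-1) (f P+_(2N) - Q+_(2N)) - 1, which tends to -1; hence tau tends to 0
    ([cvg_mobius_param]). All tails of the continued fraction then tend to 0, so its
    denominators are eventually nonzero ([Sfrac_tail_cvg]), and where they are
    nonzero the continued fraction equals the Moebius transformation
    ([Sfrac_mobius_step]). *)

(** * Reciprocal power series and Toeplitz determinants *)

Section Recip.
Variables (R : realType) (g : nat -> R).

(** The first [n] coefficients of the reciprocal of the power series
    g 0 + g 1 x + g 2 x^2 + ..., computed one after the other. *)
Fixpoint recip_seq (n : nat) : seq R :=
  if n is n'.+1 then
    let s := recip_seq n' in
    rcons s ((g 0)^-1 * ((n' == 0)%:R - \sum_(i < n') g (n' - i)%N * s`_i))
  else [::].

(** The coefficients of that reciprocal; meaningful when [g 0] is nonzero. *)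
Definition recip (n : nat) : R := (recip_seq n.+1)`_n.

Lemma size_recip_seq n : size (recip_seq n) = n.
Proof. by elim: n => //= n IHn; rewrite size_rcons IHn. Qed.

Lemma nth_recip_seq n i : (i < n)%N -> (recip_seq n)`_i = recip i.
Proof.
elim: n => // n IHn; rewrite ltnS leq_eqVlt => /predU1P[-> // | lt_in].
by rewrite /= nth_rcons size_recip_seq lt_in IHn.
Qed.

Lemma recip_conv n : g 0 != 0 ->
  \sum_(i < n.+1) g (n - i)%N * recip i = (n == 0)%:R.
Proof.
move=> g0; rewrite big_ord_recr /= subnn.
have -> : recip n = (g 0)^-1 *
    ((n == 0)%:R - \sum_(i < n) g (n - i)%N * recip i).
  rewrite {1}/recip /= nth_rcons size_recip_seq ltnn eqxx.
  by congr (_ * (_ - _)); apply: eq_bigr => i _; rewrite nth_recip_seq.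
by rewrite mulrA divff // mul1r addrC subrK.
Qed.

(** The determinants defining the sequences c^(k) are, up to sign and a power of
    the leading coefficient, the coefficients of a reciprocal series: they are
    corner cofactors of a triangular Toeplitz matrix. *)
Lemma toeplitz_det_recip (c : nat -> R) v m : (0 < v)%N ->
  (forall i, c (v.-1 + i)%N = g i) -> g 0 != 0 ->
  toeplitz_det c v m = (-1) ^+ m * g 0 ^+ m.+1 * recip m.
Proof.
move=> v0 cg g0.
pose G : 'M[R]_m.+1 := \matrix_(p, q) if (q <= p)%N then g (p - q)%N else 0.
pose E : 'cV[R]_m.+1 := \col_i recip i.
have GE : G *m E = delta_mx 0 0.
  apply/matrixP => p q; rewrite ord1 !mxE /= andbT -[RHS]/((p == 0%N :> nat)%:R).
  rewrite -(recip_conv p g0) (big_ord_widen m.+1 (fun i => g (p - i)%N * recip i)) //.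
  rewrite [RHS]big_mkcond /=; apply: eq_bigr => i _; rewrite !mxE ltnS.
  by case: ifP => // _; rewrite mul0r.
have detG : \det G = g 0 ^+ m.+1.
  rewrite det_trig; last first.
    by apply/is_trig_mxP => i j lt_ij; rewrite mxE leqNgt lt_ij.
  under eq_bigr => i _ do rewrite mxE leqnn subnn.
  by rewrite prodr_const card_ord.
(* Cramer's rule: the last entry of the first column of the inverse of G is
   a cofactor, and that column is E. *)
have : (\adj G *m (G *m E)) ord_max 0 = \det G * recip m.
  by rewrite mulmxA mul_adj_mx mul_scalar_mx !mxE.
rewrite GE -colE !mxE detG => cofG.
rewrite -mulrA -cofG /cofactor /= mulrA -exprD add0n addnn.
rewrite -signr_odd odd_double expr0 mul1r; congr (\det _).
apply/matrixP => p q; rewrite !mxE !lift0 lift_max /=.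
case: ifP => // le_qp; rewrite -cg; congr c; lia.
Qed.

End Recip.

(** * The polynomial atom as a truncated reciprocal *)

Section FirstAtom.
(** Throughout, [c (v - 1)] is the first nonzero term of [c], so that [v] is the
    first normal index. *)
Variables (R : realType) (c : nat -> R) (v : nat).
Hypotheses (v_gt0 : (0 < v)%N) (c_eq0 : forall i, (i < v.-1)%N -> c i = 0)
  (c_neq0 : c v.-1 != 0).

Local Notation g := (fun i => c (v.-1 + i)%N).
Local Notation e := (recip g).

Lemma g0_neq0 : g 0 != 0. Proof. by rewrite /= addn0. Qed.

Lemma hankel_det_first : hankel_det c v != 0.
Proof.
apply/negP => /det0P[u u_neq0 uH0].
have /rV0Pn[q1 uq1] := u_neq0.
case: (@arg_maxnP _ q1 (fun q => u 0 q != 0) (fun q => q : nat) uq1) => q0 uq0 maxq.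
have lt_i : (v.-1 - q0 < v)%N by lia.
have /rowP/(_ (Ordinal lt_i)) := uH0.
rewrite !mxE (bigD1 q0) //= big1 ?addr0 => [|q q_neq]; last first.
  rewrite !mxE /=; have [->|uq] := eqVneq (u 0 q) 0; first by rewrite mul0r.
  rewrite c_eq0 ?mulr0 //; have := maxq q uq.
  have : (q : nat) != q0 by [].
  have := ltn_ord q0; lia.
rewrite !mxE /= subnKC; last by have := ltn_ord q0; lia.
by move/eqP; rewrite mulf_eq0 (negPf uq0) (negPf c_neq0).
Qed.

(** The bordered Hankel determinant, divided by the Hankel determinant, is the monic
    polynomial of degree [v] that is orthogonal, for the functional sending z^i to
    [c i], to all polynomials of degree less than [v]. *)
Lemma hankel_bordered_det (E : {poly R}) : (size E <= v.+1)%N -> E`_v = 1 ->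
  (forall p, (p < v)%N -> \sum_(i < v.+1) c (p + i)%N * E`_i = 0) ->
  (hankel_det c v)^-1 *:
    \det (\matrix_(p < v.+1, q < v.+1)
            if (p < v)%N then (c (p + q)%N)%:P else 'X^q) = E.
Proof.
move=> sE Ev orthE; set Hp := \matrix_(p, q) _.
(* Multiplying by U replaces the last column by the combination of all columns
   with the coefficients of E, which is zero above the last row. *)
pose U : 'M[{poly R}]_v.+1 :=
  \matrix_(i, j) if j == ord_max then (E`_i)%:P else (i == j)%:R.
have detU : \det U = 1.
  rewrite -det_tr det_trig; last first.
    apply/is_trig_mxP => i j lt_ij; rewrite !mxE.
    case: eqVneq => [ij|_]; first by move: lt_ij; rewrite ij ltnNge -ltnS ltn_ord.
    by case: eqVneq => // ji; move: lt_ij; rewrite ji ltnn.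
  rewrite big1 // => i _; rewrite !mxE; case: eqVneq => [->|_].
    by rewrite /= Ev.
  by rewrite eqxx.
have -> : \det Hp = \det (Hp *m U) by rewrite det_mulmx detU mulr1.
have HUl p (q : 'I_v) : (Hp *m U) p (lift ord_max q) = Hp p (lift ord_max q).
  rewrite mxE (bigD1 (lift ord_max q)) //= big1 ?addr0.
    by rewrite [U _ _]mxE eq_sym (negPf (neq_lift _ _)) eqxx mulr1.
  move=> i i_neq; rewrite [U _ _]mxE eq_sym (negPf (neq_lift _ _)) (negPf i_neq).
  by rewrite mulr0.
have HUr p : (Hp *m U) p ord_max = if (p < v)%N then 0 else E.
  rewrite mxE; under eq_bigr => i _ do rewrite !mxE eqxx.
  case: ifP => p_lt.
    under eq_bigr => i _ do rewrite -polyCM.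
    by rewrite -rmorph_sum orthE.
  transitivity (\poly_(i < v.+1) E`_i); last first.
    apply/polyP => k; rewrite coef_poly; case: ltnP => // le_vk.
    by rewrite nth_default // (leq_trans sE).
  by rewrite poly_def; apply: eq_bigr => i _; rewrite mulrC mul_polyC.
rewrite (expand_det_col _ ord_max) (bigD1 ord_max) //= big1 ?addr0; last first.
  move=> i i_neq; rewrite HUr; case: ifP; rewrite ?mul0r // => /negbT.
  by rewrite -leqNgt => le_vi; case/eqP: i_neq; apply/val_inj => /=; have := ltn_ord i; lia.
rewrite HUr /= ltnn /cofactor addnn -signr_odd odd_double expr0 mul1r.
have -> : row' ord_max (col' ord_max (Hp *m U)) =
    map_mx (@polyC R) (\matrix_(p < v, q < v) c (p + q)%N).
  apply/matrixP => p q; rewrite [LHS]mxE [LHS]mxE HUl !mxE !lift_max.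
  by rewrite ltn_ord.
rewrite det_map_mx -/(hankel_det c v) mulrC mul_polyC scalerA.
by rewrite mulVf ?scale1r // hankel_det_first.
Qed.

(** The polynomial atom is the polynomial part of b z^v times the reciprocal of
    c_(v-1) + c_v / z + ..., where b = c_(v-1). *)
Lemma hankel_bordered_det_recip :
  (hankel_det c v)^-1 *:
    \det (\matrix_(p < v.+1, q < v.+1)
            if (p < v)%N then (c (p + q)%N)%:P else 'X^q) =
  \poly_(i < v.+1) (c v.-1 * e (v - i)%N).
Proof.
have e0 : c v.-1 * e 0 = 1.
  by have := recip_conv 0 g0_neq0; rewrite big_ord1 /= addn0.
apply: hankel_bordered_det; first exact: size_poly.
  by rewrite coef_poly ltnSn subnn.
move=> p lt_pv; have := recip_conv p.+1 g0_neq0; rewrite /= => conv0.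
under eq_bigr => i _ do rewrite coef_poly ltn_ord.
rewrite (reindex_inj rev_ord_inj) /=.
transitivity (c v.-1 * \sum_(i < v.+1) (if (i < p.+2)%N then
    c (v.-1 + (p.+1 - i))%N * e i else 0)); last first.
  rewrite -big_mkcond /=.
  by rewrite -(big_ord_widen v.+1 (fun i => c (v.-1 + (p.+1 - i))%N * e i)) ?conv0 ?mulr0.
rewrite mulr_sumr; apply: eq_bigr => i _; rewrite !subSS.
have -> : (v - (v - i) = i)%N by have := ltn_ord i; lia.
case: ifP => ip; rewrite mulrCA ?mulr0.
  by do 2 congr (_ * _); congr c; have := ltn_ord i; lia.
by rewrite [c (p + _)%N]c_eq0 ?mul0r ?mulr0 //; have := ltn_ord i; lia.
Qed.

End FirstAtom.

(** * Sequences as Laurent series at infinity *)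

Section MomentPoly.
Variable R : realType.
Implicit Types (c g h : nat -> R) (L M m : nat).

(** The polynomial c_0 z^(L-1) + ... + c_(L-1). Dividing it by - z^L gives the first
    [L] terms of the series - c_0 / z - c_1 / z^2 - ...; statements about this
    series up to order z^(-L) become bounds on sizes of polynomials. *)
Definition moment_poly L c : {poly R} := \poly_(i < L) c (L - i.+1)%N.

Lemma size_moment_poly L c : (size (moment_poly L c) <= L)%N.
Proof. exact: size_poly. Qed.

Lemma coef_moment_poly L c i : (i < L)%N -> (moment_poly L c)`_(L - i.+1) = c i.
Proof.
move=> lt_iL; rewrite coef_poly ltn_subrL /= (leq_ltn_trans _ lt_iL) //.
by congr c; lia.
Qed.

(** If the product of two power series is the constant [k], the product of their
    truncations, written with decreasing powers of the variable, is k z^(2d) up to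
    terms of degree less than [d]. *)
Lemma size_mul_reversed g h k d :
  (forall n, \sum_(i < n.+1) g (n - i)%N * h i = (n == 0)%:R * k) ->
  (size ((\poly_(i < d.+1) g (d - i)%N) * (\poly_(i < d.+1) h (d - i)%N)
         - k *: 'X^(d + d))%R <= d)%N.
Proof.
move=> conv; apply/leq_sizeP => j le_dj.
rewrite coefB coefZ coefXn coefM.
have [lt_dj|le_jd] := ltnP (d + d) j.
  rewrite big1 ?sub0r; first by rewrite gtn_eqF // mulr0 oppr0.
  move=> i _; rewrite !coef_poly; case: ifP => id; rewrite ?mul0r //.
  by case: ifP => jd; rewrite ?mulr0 //; lia.
have -> : (j == d + d)%N = (d + d - j == 0)%N by lia.
apply/eqP; rewrite subr_eq0 mulrC -conv; apply/eqP.
rewrite (reindex_inj rev_ord_inj) /=.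
transitivity (\sum_(i < j.+1) if (j - d <= i <= d)%N
    then g (d - (j - i))%N * h (d - i)%N else 0).
  apply: eq_bigr => i _; rewrite !coef_poly !subSS.
  have i_le := ltn_ord i; have -> : (j - (j - i) = i)%N by lia.
  case: (ltnP i d.+1) => id; rewrite ?mulr0 ?andbF; last by case: ifP => //; lia.
  case: (ltnP (j - i) d.+1) => jid; rewrite ?mul0r; first by case: ifP => //; lia.
  by case: ifP => //; lia.
(* Only the indices from j - d to d contribute, and they are as many as the terms
   of the convolution at d + d - j. *)
rewrite -big_mkcond /=.
rewrite -(big_mkord (fun i => (j - d <= i <= d)%N)
  (fun i => g (d - (j - i))%N * h (d - i)%N)).
rewrite (big_cat_nat (n := (j - d)%N)) //=; last by lia.
rewrite big_nat_cond big1 ?add0r; last by move=> i; lia.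
rewrite (big_cat_nat (n := d.+1)) //=; last by lia.
rewrite [X in _ + X]big_nat_cond [X in _ + X]big1 ?addr0; last by move=> i; lia.
rewrite big_nat_cond.
rewrite (eq_bigl (fun i => (j - d <= i < d.+1)%N && true)); last by move=> i; lia.
rewrite -big_nat_cond big_nat_rev /=.
rewrite -{1}[(j - d)%N]add0n big_addn big_mkord.
have -> : (d.+1 - (j - d) = (d + d - j).+1)%N by lia.
apply: eq_bigr => i _; have := ltn_ord i => i_le.
by congr (g _ * h _); lia.
Qed.

(** The reciprocal of the series c_(v-1) + c_v x + ... *)
Local Notation tail_recip c v := (recip (fun i => c (v.-1 + i)%N)).

(** One step of the continued fraction: if S and S' are the series attached to [c]
    and to the next sequence, then S = - b / (a + S'). Here it is stated for the
    truncations of S and S', with denominators cleared and [L] terms of S. *)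
Lemma continued_fraction_step c v L : (0 < v)%N -> (v.*2 <= L)%N ->
  (forall i, (i < v.-1)%N -> c i = 0) -> c v.-1 != 0 ->
  (size (moment_poly L c *
     ((\poly_(i < v.+1) (c v.-1 * tail_recip c v (v - i)%N)) * 'X^(L - v.*2)
      - moment_poly (L - v.*2) (fun i => (- c v.-1 * tail_recip c v (i + v).+1)))
   - c v.-1 *: 'X^(L + (L - v.*2)))%R <= L - v)%N.
Proof.
move=> v_gt0 le_vL c_eq0 c_neq0; set e := tail_recip c v.
have g0 : (fun i => c (v.-1 + i)%N) 0%N != 0 by rewrite addn0.
have -> : moment_poly L c = \poly_(i < (L - v).+1) c (v.-1 + (L - v - i))%N.
  apply/polyP => i; rewrite !coef_poly.
  case: ltnP => iL; case: ltnP => ivL; [|by rewrite c_eq0 //; lia|lia|by []].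
  by congr c; lia.
set B := (X in _ * X).
have -> : B = \poly_(i < (L - v).+1) (c v.-1 * e (L - v - i)%N).
  apply/polyP => i; rewrite coefB coefMXn !coef_poly.
  case: ltnP => iL.
    case: ifP => [_|]; last by lia.
    by rewrite sub0r mulNr opprK; congr (_ * e _); lia.
  rewrite subr0; case: ltnP => iv; case: ltnP => ivL; [|lia|lia|by []].
  by congr (_ * e _); lia.
have -> : (L + (L - v.*2) = (L - v) + (L - v))%N by lia.
apply: size_mul_reversed (fun i => c (v.-1 + i)%N) (fun i => c v.-1 * e i) _ _ _ => n.
rewrite -(@recip_conv _ (fun i => c (v.-1 + i)%N) n g0) mulr_suml; apply: eq_bigr => i _.
by rewrite mulrA mulrAC.
Qed.

(** The moment functional that sends z^i to c_i, applied to z^i [v], is read off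
    from a coefficient of the product. *)
Lemma coef_mul_moment_poly M c m (v : {poly R}) i :
  (i < m)%N -> (m + m <= M)%N -> (size v <= m)%N ->
  (moment_poly M c * v)`_(M - i.+1) = \sum_(q < m) v`_q * c (q + i)%N.
Proof.
move=> im mM sv; rewrite mulrC coefM.
transitivity (\sum_(q < (M - i.+1).+1 | (q < m)%N) v`_q * c (q + i)%N).
  rewrite [RHS]big_mkcond /=; apply: eq_bigr => q _.
  case: ltnP => qm; last by rewrite nth_default ?mul0r // (leq_trans sv).
  congr (_ * _); rewrite coef_poly; case: ltnP => [_|]; last by lia.
  by congr c; lia.
by rewrite -(big_ord_widen _ (fun q => v`_q * c (q + i)%N)) //; lia.
Qed.

Lemma mod_Xn_size M m (p : {poly R}) : (m <= M)%N ->
  (forall i, (i < m)%N -> p`_(M - i.+1) = 0) ->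
  exists w, (size (p + 'X^M * w)%R <= M - m)%N.
Proof.
move=> mM p0; exists (- drop_poly M p).
rewrite -{1}(poly_take_drop M p) mulrN mulrC addrK.
apply/leq_sizeP => j le_j; rewrite coef_take_poly; case: ltnP => // jM.
have -> : j = (M - (M - j.+1).+1)%N by lia.
by apply: p0; lia.
Qed.

(** A Hankel determinant of order [m] vanishes iff some nonzero denominator [v] of
    degree less than [m] makes v S equal to a polynomial up to O(z^(-m-1)). *)
Lemma hankel_det_eq0P M c m : (m + m <= M)%N ->
  reflect (exists v w : {poly R}, [/\ v != 0, (size v <= m)%N &
     (size (moment_poly M c * v + 'X^M * w)%R <= M - m)%N])
    (hankel_det c m == 0).
Proof.
move=> mM; apply: (iffP det0P) => [[u u0 uH]|[v [w [v0 sv sw]]]].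
  have su : (size (rVpoly u) <= m)%N by exact: size_poly.
  have le_mM : (m <= M)%N by lia.
  have [i im|w sw] := @mod_Xn_size M m (moment_poly M c * rVpoly u) le_mM.
    rewrite (coef_mul_moment_poly c im mM su).
    have /rowP/(_ (Ordinal im)) := uH; rewrite !mxE => ui; rewrite -[RHS]ui.
    by apply: eq_bigr => q _; rewrite !mxE coef_rVpoly_ord.
  exists (rVpoly u), w; split=> //.
  by apply: contra u0 => /eqP u0; rewrite -[u]rVpolyK u0 linear0.
exists (poly_rV v).
  by apply: contra v0 => /eqP v0; rewrite -[v](poly_rV_K sv) v0 linear0.
apply/rowP => i; rewrite !mxE.
have iM := ltn_ord i.
have : (moment_poly M c * v + 'X^M * w)`_(M - i.+1) = 0.
  by apply: (leq_sizeP _ _ sw); lia.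
rewrite coefD coefXnM ifT ?addr0; last by lia.
rewrite (coef_mul_moment_poly c iM mM sv) => vi; rewrite -[RHS]vi.
by apply: eq_bigr => q _; rewrite !mxE.
Qed.

End MomentPoly.

(** * Normal indices and degrees of denominators *)

Section NormalIndices.
Variables (R : realType) (nf : nat) (c : nat -> R).
Local Notation N := (normal_count nf c).
Local Notation ni := (normal_index nf c).

Lemma mem_normal_indices m :
  (m \in normal_indices nf c) = (0 < m <= nf)%N && (hankel_det c m != 0).
Proof. by rewrite mem_filter mem_iota add1n ltnS andbC. Qed.

Lemma normal_index_in k : (k < N)%N -> ni k.+1 \in normal_indices nf c.
Proof. by move=> kN; apply: mem_nth. Qed.

Lemma normal_index_ltn j k : (j < k <= N)%N -> (ni j < ni k)%N.
Proof.
case/andP=> lt_jk le_kN; rewrite /normal_index.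
have srt : sorted ltn (0%N :: normal_indices nf c).
  rewrite /= path_min_sorted; last first.
    by apply/allP => m; rewrite mem_normal_indices => /andP[/andP[]].
  by apply: sorted_filter (iota_ltn_sorted _ _); exact: ltn_trans.
have szE : size (normal_indices nf c) = N by [].
by apply: (sorted_ltn_nth ltn_trans 0%N srt); rewrite // inE /= szE; lia.
Qed.

Lemma normal_index_leq j k : (j <= k <= N)%N -> (ni j <= ni k)%N.
Proof.
case/andP; rewrite leq_eqVlt => /predU1P[-> // | jk kN].
by rewrite ltnW // normal_index_ltn // jk.
Qed.

Lemma normal_index_le k : (k <= N)%N -> (ni k <= nf)%N.
Proof.
case: k => // k /normal_index_in; rewrite mem_normal_indices.
by case/andP => /andP[].
Qed.

Lemma normal_index_min k m : (k < N)%N -> (ni k < m <= nf)%N ->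
  hankel_det c m != 0 -> (ni k.+1 <= m)%N.
Proof.
move=> kN /andP[lt_km m_le] Dm.
have : m \in normal_indices nf c by rewrite mem_normal_indices Dm m_le; lia.
case/(nthP 0%N) => j; rewrite -/(normal_count nf c) => jN jE.
have mE : m = ni j.+1 by rewrite -jE.
case: (ltngtP j k) => [jk|kj|jk]; last by rewrite mE jk.
  by move: lt_km; rewrite mE ltnNge normal_index_leq // jk ltnW.
by rewrite mE normal_index_leq // ltnS ltnW.
Qed.

Lemma normal_index_last : nf \in normal_indices nf c -> ni N = nf.
Proof.
move=> /(nthP 0%N)[j]; rewrite -/(normal_count nf c) => jN jE.
have nfE : nf = ni j.+1 by rewrite /normal_index /= jE.
apply/eqP; rewrite eqn_leq normal_index_le //= {1}nfE.
by rewrite normal_index_leq // jN leqnn.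
Qed.

End NormalIndices.

Section Convergents.
Variables (R : realType) (c : nat -> R) (M : nat).

(** A convergent with denominator [P] of degree [n], coprime to its numerator, whose
    remainder has order exactly [e], jumps from [n] to [e], which is then the first normal
    index beyond [n]: [P] is a kernel vector for the Hankel matrices of order strictly
    between [n] and [e], and a kernel vector of order [e] would be a multiple of [P]
    with too small a remainder. *)
Lemma hankel_det_convergent (P Q P' Q' : {poly R}) (beta : R) n e :
  P * Q' - P' * Q = beta%:P -> beta != 0 -> size P = n.+1 -> (n < e)%N ->
  (e + e <= M)%N -> size (moment_poly M c * P + 'X^M * Q)%R = (M - e).+1 ->
  (forall m, (n < m < e)%N -> hankel_det c m = 0) /\ hankel_det c e != 0.
Proof.
move=> PQ beta0 sP lt_ne le_eM sr; split=> [m /andP[nm me]|].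
  apply/eqP/(@hankel_det_eq0P _ M); first by lia.
  exists P, Q; by rewrite -size_poly_gt0 sP sr; split=> //; apply: ltn_sub2l => //; lia.
apply/negP => /(@hankel_det_eq0P _ M c e le_eM)[v [w [v0 sv sw]]].
set A := moment_poly M c in sr sw *.
have vQwP : v * Q = w * P.
  apply/eqP; rewrite -subr_eq0; apply/negPn/negP => vQ0.
  have : (size ((v * Q - w * P) * 'X^M)%R <= M)%N.
    have -> : (v * Q - w * P) * 'X^M =
      v * (A * P + 'X^M * Q) - P * (A * v + 'X^M * w) by ring.
    apply: (leq_trans (size_polyD _ _)); rewrite size_polyN geq_max; apply/andP; split.
      apply: (leq_trans (size_polyMleq _ _)); rewrite sr; lia.
    apply: (leq_trans (size_polyMleq _ _)); rewrite sP.
    apply: (@leq_trans (n.+1 + (M - e)).-1); last by lia.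
    by rewrite -!subn1 leq_sub2r // leq_add2l.
  rewrite size_mulXn // leqNgt -addn1 leq_add2l.
  by rewrite size_poly_gt0 vQ0.
pose g := beta^-1 *: (v * Q' - P' * w).
have vE : v = g * P.
  apply: (@mulfI _ beta%:P); first by rewrite polyC_eq0.
  rewrite -{1}PQ /g -scalerAl mul_polyC scalerA mulfV // scale1r.
  have -> : (P * Q' - P' * Q) * v = P * Q' * v - P' * (v * Q) by ring.
  by rewrite vQwP; ring.
have P0 : P != 0 by rewrite -size_poly_gt0 sP.
have wE : w = g * Q.
  by apply: (mulIf P0); rewrite -vQwP vE; ring.
have g0 : g != 0 by apply: contra v0 => /eqP g0; rewrite vE g0 mul0r.
have r0 : A * P + 'X^M * Q != 0 by rewrite -size_poly_gt0 sr.
move: sw; rewrite vE wE.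
have -> : A * (g * P) + 'X^M * (g * Q) = g * (A * P + 'X^M * Q) by ring.
rewrite size_mul // sr addnS /= leqNgt -[X in (X < _)%N]add0n ltn_add2r.
by rewrite size_poly_gt0 g0.
Qed.

End Convergents.

(** * The continued fraction of a sequence *)

Section Tower.
Variables (R : realType) (nf : nat) (c : nat -> R).
Local Notation N := (normal_count nf c).
Local Notation ni := (normal_index nf c).
Local Notation a := (a nf c).
Local Notation b := (b nf c).
(** All series are truncated after their first M = 2 nf terms. *)
Local Notation M := (nf + nf)%N.
Local Notation A := (moment_poly M c).

(** The pair (y_(k-1), y_k), for the solution of the recurrence
    y_(k+1) = a_k y_k - b_k y_(k-1) starting at (y_(-1), y_0) = (u, v). *)
Fixpoint pfrac_pair (u v : {poly R}) (k : nat) : {poly R} * {poly R} :=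
  if k is k'.+1 then
    let: (y0, y1) := pfrac_pair u v k' in (y1, a k' * y1 - b k' *: y0)
  else (u, v).

Lemma first_kind_pairE k : first_kind_pair nf c k = pfrac_pair 0 1 k.
Proof. by elim: k => //= k ->. Qed.

Lemma pfrac_pairS1 u v k : (pfrac_pair u v k.+1).1 = (pfrac_pair u v k).2.
Proof. by rewrite /=; case: (pfrac_pair u v k). Qed.

Lemma pfrac_pairS2 u v k : (pfrac_pair u v k.+1).2 =
  a k * (pfrac_pair u v k).2 - b k *: (pfrac_pair u v k).1.
Proof. by rewrite /=; case: (pfrac_pair u v k). Qed.

Local Notation P k := (pfrac_pair 0 1 k).2.
Local Notation Q k := (pfrac_pair 1 0 k).2.
Local Notation P' k := (pfrac_pair 0 1 k).1.
Local Notation Q' k := (pfrac_pair 1 0 k).1.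
Local Notation r k := (A * P k + 'X^M * Q k).
Local Notation r' k := (A * P' k + 'X^M * Q' k).

(** Numerators and denominators of convergents are coprime as long as no b_i
    vanishes. *)
Lemma pfrac_det k : P k * Q' k - P' k * Q k = (\prod_(i < k) b i)%:P.
Proof.
elim: k => [|k IHk]; first by rewrite big_ord0 /= mulr1 mulr0 subr0.
rewrite big_ord_recr /= polyCM -IHk -/(pfrac_pair _ _ k.+1) !pfrac_pairS1 !pfrac_pairS2.
by rewrite -!mul_polyC; ring.
Qed.

(** The state of the continued fraction after [k] steps. The denominator [P k] has
    degree the [k]-th normal index, no b_i vanishes so far, the previous remainder
    [r' k] has the expected degree, and the quotient of two successive remainders
    agrees with c^(k)_0 / z + c^(k)_1 / z^2 + ... on its first M - 2 n_k terms. *)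
Definition pfrac_inv k :=
  [/\ size (P k) = (ni k).+1, (size (P' k) <= ni k)%N,
      \prod_(i < k) b i != 0,
      size (r' k) = (M - ni k).+1 &
      (size ('X^(M - (ni k).*2) * r k
        - moment_poly (M - (ni k).*2) (pseq nf c k) * r' k)%R <= M - ni k)%N].

Lemma size_pfrac_remainder k : (k <= N)%N -> pfrac_inv k ->
  (size (r k) <= M - ni k)%N.
Proof.
move=> kN [_ _ _ sr' srel]; have le_k := normal_index_le kN.
have [->|r0] := eqVneq (r k) 0; first by rewrite size_poly0.
set L := (M - (ni k).*2)%N in srel *.
have : (size (r k * 'X^L)%R <= L + (M - ni k))%N.
  rewrite mulrC -(subrK (moment_poly L (pseq nf c k) * r' k) ('X^L * r k)).
  apply: (leq_trans (size_polyD _ _)); rewrite geq_max; apply/andP; split.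
    by apply: (leq_trans srel); lia.
  apply: (leq_trans (size_polyMleq _ _)); rewrite sr' addnS /= leq_add2r.
  exact: size_moment_poly.
by rewrite size_mulXn // leq_add2l.
Qed.

(** The first nonzero term of c^(k) is at nu_(k+1) - 1: this is how the recursive
    definition of the atoms, which refers to the normal indices of [c], matches the
    continued fraction. *)
Lemma normal_index_pfrac k : nf \in normal_indices nf c -> (k < N)%N -> pfrac_inv k ->
  [/\ size (r k) = (M - ni k.+1).+1,
      (forall i, (i < (nu nf c k.+1).-1)%N -> pseq nf c k i = 0) &
      pseq nf c k (nu nf c k.+1).-1 != 0].
Proof.
move=> nf_in kN inv; have sr_le := size_pfrac_remainder (ltnW kN) inv.
case: inv => sP _ beta0 sr' srel.
have lt_k : (ni k < ni k.+1)%N by rewrite normal_index_ltn // ltnSn.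
have le_k : (ni k.+1 <= nf)%N by rewrite normal_index_le.
have P0 : P k != 0 by rewrite -size_poly_gt0 sP.
have sr_gt : (M - ni k.+1 < size (r k))%N.
  rewrite ltnNge; apply/negP => sr_small.
  have := normal_index_in kN; rewrite mem_normal_indices => /andP[_ /negP[]].
  apply/(@hankel_det_eq0P _ M); first by lia.
  by exists (P k), (Q k); split; rewrite ?sP.
(* The order of the remainder is a normal index, hence the next one. *)
pose e := (M - (size (r k)).-1)%N.
have sr : size (r k) = (M - e).+1 by rewrite /e; lia.
have [_ De] : (forall m, (ni k < m < e)%N -> hankel_det c m = 0)
    /\ hankel_det c e != 0.
  by apply: (@hankel_det_convergent _ c M _ _ _ _ _ _ _ (pfrac_det k)) => //; lia.
have eE : e = ni k.+1.
  apply/eqP; rewrite eqn_leq; apply/andP; split; first by lia.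
  by apply: normal_index_min => //; lia.
rewrite eE in sr; set L := (M - (ni k).*2)%N in srel *.
have vE : nu nf c k.+1 = (ni k.+1 - ni k)%N by [].
set v := nu nf c k.+1 in vE *.
have r0 : r k != 0 by rewrite -size_poly_gt0 sr.
have r'0 : r' k != 0 by rewrite -size_poly_gt0 sr'.
have sA : size (moment_poly L (pseq nf c k)) = (L - v).+1.
  have sX : size ('X^L * r k) = (L + (M - ni k.+1).+1)%N.
    by rewrite mulrC size_mulXn // sr.
  have sY : size (moment_poly L (pseq nf c k) * r' k) = (L + (M - ni k.+1).+1)%N.
    rewrite -sX -[moment_poly L _ * _](subKr ('X^L * r k)) size_polyDl // size_polyN sX.
    by apply: (leq_ltn_trans srel); lia.
  have A0 : moment_poly L (pseq nf c k) != 0.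
    by apply/eqP => A0; move: sY; rewrite A0 mul0r size_poly0 addnS.
  have LE : L = (M - (ni k).*2)%N by [].
  have : size (moment_poly L (pseq nf c k) * r' k) =
      (size (moment_poly L (pseq nf c k)) + size (r' k)).-1 by exact: size_mul.
  by rewrite sY sr'; lia.
(* The degree of the moment polynomial of c^(k) locates its first nonzero term. *)
split=> // [i iv|].
  have iL : (i < L)%N by lia.
  rewrite -(coef_moment_poly (pseq nf c k) iL) nth_default // sA; lia.
have iL : (v.-1 < L)%N by lia.
rewrite -(coef_moment_poly (pseq nf c k) iL).
have -> : (L - v.-1.+1 = (size (moment_poly L (pseq nf c k))).-1)%N by rewrite sA; lia.
by rewrite -/(lead_coef _) lead_coef_eq0 -size_poly_gt0 sA.
Qed.

Lemma pseqS k i : (0 < nu nf c k.+1)%N -> pseq nf c k (nu nf c k.+1).-1 != 0 ->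
  pseq nf c k.+1 i = - b k *
    recip (fun j => pseq nf c k ((nu nf c k.+1).-1 + j)%N) (i + nu nf c k.+1).+1.
Proof.
move=> v_gt0 b0; rewrite /= /b.
rewrite (@toeplitz_det_recip _ (fun j => pseq nf c k ((nu nf c k.+1).-1 + j)%N)) ?addn0 //.
set v := nu nf c k.+1; set g := pseq nf c k v.-1 in b0 *.
rewrite mulrA; congr (_ * _).
rewrite [(-1) ^+ (i + v).+1]exprS [g ^+ (i + v).+2]exprS.
have gn0 : g ^+ (i + v).+1 != 0 by rewrite expf_neq0.
have : (-1) ^+ (i + v) * (-1) ^+ (i + v) = 1 :> R.
  by rewrite -exprD addnn -signr_odd odd_double.
move: ((-1) ^+ (i + v)) (g ^+ (i + v).+1) gn0 => s G G0 ss.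
have -> : s / G * (-1 * s * (g * G)) = - (s * s) * g * (G / G) by ring.
by rewrite ss divff // mulr1 mulN1r.
Qed.

Lemma a_recip k : (0 < nu nf c k.+1)%N ->
  (forall i, (i < (nu nf c k.+1).-1)%N -> pseq nf c k i = 0) ->
  pseq nf c k (nu nf c k.+1).-1 != 0 ->
  a k = \poly_(i < (nu nf c k.+1).+1)
    (b k * recip (fun j => pseq nf c k ((nu nf c k.+1).-1 + j)%N) (nu nf c k.+1 - i)%N).
Proof. exact: hankel_bordered_det_recip. Qed.

Lemma size_a k : (0 < nu nf c k.+1)%N ->
  (forall i, (i < (nu nf c k.+1).-1)%N -> pseq nf c k i = 0) ->
  pseq nf c k (nu nf c k.+1).-1 != 0 -> size (a k) = (nu nf c k.+1).+1.
Proof.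
move=> v_gt0 c0 b0; rewrite a_recip // size_poly_eq //= subnn.
have g0 : pseq nf c k ((nu nf c k.+1).-1 + 0)%N != 0 by rewrite addn0.
have := @recip_conv _ (fun j => pseq nf c k ((nu nf c k.+1).-1 + j)%N) 0 g0.
rewrite big_ord1 /= addn0 => ->; exact: oner_neq0.
Qed.

(** If rk / rk' agrees with - S up to a small error and S = - bk / (ak + S'), then the
    next remainder ak rk - bk rk' is - S' rk up to a correspondingly small error.
    Here S and S' are represented by their moment polynomials [Ak] and [Ak1]. *)
Lemma remainder_step (L L' v m : nat) (Ak Ak1 ak rk rk' : {poly R}) (bk : R) :
  (L' + v.*2 = L)%N -> (v <= m)%N ->
  size rk' = m.+1 -> size ak = v.+1 -> (size Ak1 <= L')%N ->
  (size ('X^L * rk - Ak * rk')%R <= m)%N ->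
  (size (Ak * (ak * 'X^L' - Ak1) - bk *: 'X^(L + L'))%R <= L - v)%N ->
  (size ('X^L' * (ak * rk - bk *: rk') - Ak1 * rk)%R <= m - v)%N.
Proof.
move=> LL' vm sr' sa sA1 srel sstep.
set D : {poly R} := 'X^L' * (ak * rk - bk *: rk') - Ak1 * rk.
have [->|D0] := eqVneq D 0; first by rewrite size_poly0.
have : (size (D * 'X^L)%R <= L - v + m)%N.
  have -> : D * 'X^L = ('X^L * rk - Ak * rk') * (ak * 'X^L' - Ak1)
      + (Ak * (ak * 'X^L' - Ak1) - bk *: 'X^(L + L')) * rk'.
    by rewrite /D exprD -!mul_polyC; ring.
  have sB : (size (ak * 'X^L' - Ak1)%R <= (L' + v).+1)%N.
    apply: (leq_trans (size_polyD _ _)); rewrite size_polyN geq_max.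
    rewrite size_mulXn -?size_poly_gt0 ?sa // addnS leqnn /=.
    by apply: (leq_trans sA1); lia.
  apply: (leq_trans (size_polyD _ _)); rewrite geq_max; apply/andP; split.
    apply: (leq_trans (size_polyMleq _ _)).
    apply: (@leq_trans (m + (L' + v).+1).-1); last by lia.
    by rewrite -!subn1 leq_sub2r // leq_add.
  apply: (leq_trans (size_polyMleq _ _)).
  by rewrite sr' addnS /= leq_add2r.
by rewrite size_mulXn //; lia.
Qed.

Lemma pfrac_inv0 : pfrac_inv 0.
Proof.
split; rewrite /= ?big_ord0 ?oner_neq0 ?size_poly0 ?size_poly1 //.
  by rewrite mulr0 add0r mulr1 size_polyXn subn0.
by rewrite !mulr0 !mulr1 addr0 add0r subn0 mulrC subrr size_poly0.
Qed.

Lemma pfrac_invS k : nf \in normal_indices nf c -> (k < N)%N -> pfrac_inv k ->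
  pfrac_inv k.+1.
Proof.
move=> nf_in kN inv; have [sr c0 b0] := normal_index_pfrac nf_in kN inv.
have lt_k : (ni k < ni k.+1)%N by rewrite normal_index_ltn // ltnSn.
have le_k : (ni k.+1 <= nf)%N by rewrite normal_index_le.
have vE : nu nf c k.+1 = (ni k.+1 - ni k)%N by [].
have v_gt0 : (0 < nu nf c k.+1)%N by rewrite vE; lia.
have sa := size_a v_gt0 c0 b0.
case: inv => sP sP' beta0 sr' srel.
split.
- rewrite pfrac_pairS2.
  have saP : size (a k * P k) = (ni k.+1).+1.
    by rewrite size_mul -?size_poly_gt0 ?sa ?sP //; lia.
  rewrite size_polyDl // size_polyN saP.
  by apply: (leq_ltn_trans (size_scale_leq _ _)); rewrite ltnS (leq_trans sP') // ltnW.
- by rewrite pfrac_pairS1 sP.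
- by rewrite big_ord_recr /= mulf_neq0.
- by rewrite !pfrac_pairS1.
have le_v : ((nu nf c k.+1).*2 <= M - (ni k).*2)%N by rewrite vE; lia.
have sstep := continued_fraction_step v_gt0 le_v c0 b0.
have LE : (M - (ni k).*2 - (nu nf c k.+1).*2 = M - (ni k.+1).*2)%N by rewrite vE; lia.
rewrite -a_recip // LE in sstep.
rewrite !pfrac_pairS1 !pfrac_pairS2.
have -> : A * (a k * P k - b k *: P' k) + 'X^M * (a k * Q k - b k *: Q' k) =
  a k * r k - b k *: r' k by rewrite -!mul_polyC; ring.
have -> : (M - ni k.+1 = M - ni k - nu nf c k.+1)%N by rewrite vE; lia.
apply: (remainder_step _ _ sr' sa _ srel).
- by rewrite vE; lia.
- by rewrite vE; lia.
- exact: size_moment_poly.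
suff -> : moment_poly (M - (ni k.+1).*2) (pseq nf c k.+1) =
    moment_poly (M - (ni k.+1).*2) (fun i => - pseq nf c k (nu nf c k.+1).-1 *
      recip (fun j => pseq nf c k ((nu nf c k.+1).-1 + j)%N) (i + nu nf c k.+1).+1)
  by exact: sstep.
by apply/polyP => i; rewrite !coef_poly; case: ifP => // _; rewrite pseqS.
Qed.

Lemma pfrac_invP k : nf \in normal_indices nf c -> (k <= N)%N -> pfrac_inv k.
Proof.
move=> nf_in; elim: k => [_|k IHk kN]; first exact: pfrac_inv0.
exact/pfrac_invS/IHk/ltnW.
Qed.

End Tower.

(** * Stieltjes polynomials and P-fraction denominators *)

Section Stieltjes.
Variables (R : realType) (nf : nat) (c : nat -> R).
Local Notation N := (normal_count nf c).
Local Notation a := (a nf c).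
Local Notation b := (b nf c).
Local Notation l := (l_atom nf c).
Local Notation d := (d_atom nf c).
Local Notation m := (m_atom nf c).
Local Notation st := (stieltjes_pair nf c).
Local Notation pf := (pfrac_pair nf c).

Lemma d_atom1 : d 1 = (b 0)^-1.
Proof. by rewrite /d_atom /= div1r. Qed.

Lemma l_atom1 : l 1 = - (d 1 * (a 0).[0])^-1.
Proof. by rewrite /l_atom /d_atom /= !div1r. Qed.

Lemma d_atomS j : d j.+2 = (b j.+1 * l j.+1 ^+ 2 * d j.+1)^-1.
Proof. by rewrite /d_atom /l_atom /=; case: (dl nf c j) => x y /=; rewrite div1r. Qed.

Lemma l_atomS j : l j.+2 = - (l j.+1 / (1 + l j.+1 * d j.+2 * (a j.+1).[0])).
Proof. by rewrite /d_atom /l_atom /=; case: (dl nf c j). Qed.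

Lemma mulX_m_atom j : 'X * m j.+1 = d j.+1 *: (a j - (a j).[0]%:P).
Proof.
rewrite mulrC divpK // -['X]subr0 -polyC0 dvdp_XsubCl.
by rewrite /root hornerZ hornerD hornerN hornerC subrr mulr0.
Qed.

Lemma stieltjes_pair_prev u v k : (st u v k.+1).1 = (st u v k).2.
Proof. by rewrite /=; case: (st u v k). Qed.

Lemma stieltjes_pair_double u v j :
  (st u v j.+1.*2).1 = (st u v j.*2).1 - 'X * m j.+1 * (st u v j.*2).2 /\
  (st u v j.+1.*2).2 = (st u v j.*2).2 + l j.+1 *: (st u v j.+1.*2).1.
Proof.
rewrite doubleS /=; case: (st u v j.*2) => y0 y1 /=.
by rewrite odd_double /= doubleK uphalf_double.
Qed.

Lemma stieltjes_det j :
  (st 0 1 j.*2).2 * (st 1 0 j.*2).1 - (st 0 1 j.*2).1 * (st 1 0 j.*2).2 = 1.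
Proof.
elim: j => [|j IHj]; first by rewrite /= mulr1 mulr0 subr0.
have [P1 P2] := stieltjes_pair_double 0 1 j.
have [Q1 Q2] := stieltjes_pair_double 1 0 j.
by rewrite -[RHS]IHj P2 Q2 P1 Q1 -!mul_polyC; ring.
Qed.

Lemma stieltjes_at0 j : (st 0 1 j.*2).1.[0] = 0 /\ (st 0 1 j.*2).2.[0] = 1.
Proof.
elim: j => [|j [IH1 IH2]]; first by rewrite /= !hornerC.
have [P1 P2] := stieltjes_pair_double 0 1 j.
rewrite P2 P1 !(hornerD, hornerN, hornerZ, hornerM, hornerX, IH1, IH2).
by rewrite !mul0r subr0 mulr0 addr0.
Qed.

(** The ratio of the Stieltjes polynomials of index 2j to the polynomials of index
    [j] of the P-fraction. *)
Definition scale_factor j : R := \prod_(i < j) - (l i.+1 * d i.+1).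

Lemma scale_factorS j : scale_factor j.+1 = - (l j.+1 * d j.+1) * scale_factor j.
Proof. by rewrite /scale_factor big_ord_recr /= mulrC. Qed.

(** Contracting the Stieltjes recurrence to even indices gives the P-fraction
    recurrence up to scaling, whatever the initial values. Nonvanishing of the atoms
    d and l is part of the induction: the denominator of l_(j+2) is a nonzero
    multiple of the value at 0 of the next polynomial of the first kind. *)
Lemma stieltjes_pfrac j : (forall k, (k < N)%N -> b k != 0) -> regular nf c ->
  (j < N)%N ->
  [/\ d j.+1 != 0, l j.+1 != 0 & forall u v,
    (st u v j.+1.*2).2 = scale_factor j.+1 *: (pf u v j.+1).2 /\
    l j.+1 *: (st u v j.+1.*2).1 =
      scale_factor j.+1 *: (pf u v j.+1).2 - scale_factor j *: (pf u v j.+1).1].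
Proof.
move=> b_neq0 reg; elim: j => [|j IHj] jN.
  have b0 := b_neq0 0 jN.
  have a0 : (a 0).[0] != 0.
    have /reg : (1 <= 1 <= N)%N by [].
    by rewrite /first_kind /= mulr1 scaler0 subr0.
  have d1 : d 1 != 0 by rewrite d_atom1 invr_eq0.
  have l1 : l 1 != 0 by rewrite l_atom1 oppr_eq0 invr_eq0 mulf_neq0.
  have sc1 : scale_factor 1 = - (l 1 * d 1) by rewrite /scale_factor big_ord1.
  have ld : l 1 * d 1 * (a 0).[0] = - 1.
    by rewrite l_atom1 mulNr mulNr -mulrA mulVf // mulf_neq0.
  have bd : b 0 * d 1 = 1 by rewrite d_atom1 mulfV.
  split=> // u v.
  have [-> ->] := stieltjes_pair_double u v 0; have [-> _] := stieltjes_pair_double u v 0.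
  rewrite pfrac_pairS1 pfrac_pairS2 mulX_m_atom sc1 /scale_factor big_ord0 /=.
  have E : v + l 1 *: (u - d 1 *: (a 0 - (a 0).[0]%:P) * v) =
      - (l 1 * d 1) *: (a 0 * v - b 0 *: u).
    apply/eqP; rewrite -subr_eq0; apply/eqP.
    transitivity ((l 1 * d 1 * (a 0).[0] + 1)%:P * v + (l 1 * (1 - b 0 * d 1))%:P * u).
      by rewrite -!mul_polyC; ring.
    by rewrite ld bd subrr mulr0 addNr !mul0r addr0.
  by split=> //; rewrite -E scale1r addrAC subrr add0r.
have [d0 l0 inv] := IHj (ltnW jN).
have b0 := b_neq0 _ jN.
have d'0 : d j.+2 != 0.
  rewrite d_atomS invr_eq0.
  exact: mulf_neq0 (mulf_neq0 b0 (expf_neq0 2 l0)) d0.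
have db : d j.+2 * b j.+1 * l j.+1 * l j.+1 * d j.+1 = 1.
  by rewrite d_atomS; field; rewrite b0 l0 d0.
(* The Stieltjes polynomials of even index take the value 1 at 0, which
   determines the values at 0 of the polynomials of the first kind. *)
have [P2 P1] := inv 0 1.
have P2_0 : scale_factor j.+1 * (pf 0 1 j.+1).2.[0] = 1.
  by have [_] := stieltjes_at0 j.+1; rewrite P2 hornerZ.
have P1_0 : scale_factor j * (pf 0 1 j.+1).1.[0] = 1.
  have [P10 _] := stieltjes_at0 j.+1.
  have := congr1 (horner^~ 0) P1; rewrite hornerZ P10 mulr0 hornerD hornerN !hornerZ P2_0.
  by move/eqP; rewrite eq_sym subr_eq0 => /eqP.
have k0 : 1 + l j.+1 * d j.+2 * (a j.+1).[0] != 0.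
  have /reg : (1 <= j.+2 <= N)%N by [].
  have hornerE3 (p y y' : {poly R}) (k x : R) :
    (p * y - k *: y').[x] = p.[x] * y.[x] - k * y'.[x].
    by rewrite hornerD hornerN hornerM hornerZ.
  rewrite /first_kind first_kind_pairE pfrac_pairS2 hornerE3.
  apply: contra => /eqP k0.
  have s0 : scale_factor j.+1 != 0.
    by apply: contra_eq_neq P2_0 => ->; rewrite mul0r eq_sym oner_neq0.
  apply/eqP/(mulfI s0)/(mulfI l0)/(mulfI d'0); rewrite !mulr0.
  have bdl : - (d j.+2 * b j.+1 * l j.+1 * scale_factor j.+1) = scale_factor j.
    by rewrite scale_factorS -[RHS]mul1r -db; ring.
  transitivity (l j.+1 * d j.+2 * (a j.+1).[0] * (scale_factor j.+1 * (pf 0 1 j.+1).2.[0])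
    - d j.+2 * b j.+1 * l j.+1 * scale_factor j.+1 * (pf 0 1 j.+1).1.[0]); first by ring.
  by rewrite -mulNr bdl P1_0 P2_0 mulr1 addrC.
have lk : l j.+2 * (1 + l j.+1 * d j.+2 * (a j.+1).[0]) = - l j.+1.
  by rewrite l_atomS mulNr divfK.
split=> //; first by rewrite l_atomS oppr_eq0 mulf_neq0 // invr_eq0.
move=> u v; have {P2 P1 P2_0 P1_0}[y1E y0E] := inv u v.
have [-> ->] := stieltjes_pair_double u v j.+1.
have [-> _] := stieltjes_pair_double u v j.+1.
rewrite pfrac_pairS1 pfrac_pairS2 mulX_m_atom.
move: y1E y0E; set y1 := (st _ _ _).2; set y0 := (st _ _ _).1.
set Y1 := (pf _ _ _).2; set Y0 := (pf _ _ _).1 => y1E y0E.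
have E : y1 + l j.+2 *: (y0 - d j.+2 *: (a j.+1 - (a j.+1).[0]%:P) * y1) =
    scale_factor j.+2 *: (a j.+1 * Y1 - b j.+1 *: Y0).
  apply: (@mulfI _ (l j.+1)%:P); first by rewrite polyC_eq0.
  rewrite scale_factorS mulrDr mul_polyC mul_polyC scalerA mulrC -scalerA scalerBr y0E.
  rewrite y1E; apply/eqP; rewrite -subr_eq0; apply/eqP.
  transitivity ((scale_factor j.+1 * (l j.+2 * (1 + l j.+1 * d j.+2 * (a j.+1).[0])
       + l j.+1))%:P * Y1
    - (l j.+2 * (scale_factor j + l j.+1 * d j.+2 * b j.+1 * scale_factor j.+1))%:P * Y0).
    by rewrite -!mul_polyC; ring.
  rewrite lk addNr mulr0 mul0r sub0r.
  have -> : scale_factor j + l j.+1 * d j.+2 * b j.+1 * scale_factor j.+1 = 0.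
    rewrite scale_factorS -[X in X + _]mul1r -db; ring.
  by rewrite mulr0 mul0r oppr0.
by split=> //; rewrite -E y1E addrAC subrr add0r.
Qed.

End Stieltjes.

(** * Degrees, determinant, and the Moebius form *)

Section Summary.
Variables (R : realType) (nf : nat) (c : nat -> R).
Hypotheses (nf_normal : nf \in normal_indices nf c) (c_regular : regular nf c).
Local Notation N := (normal_count nf c).
Local Notation M := (nf + nf)%N.
Local Notation A := (moment_poly M c).
Local Notation P := (Pplus nf c).
Local Notation Q := (Qplus nf c).

Lemma normal_count_gt0 : (0 < N)%N.
Proof. by move: nf_normal; rewrite /normal_count; case: normal_indices. Qed.

Lemma b_neq0 k : (k < N)%N -> b nf c k != 0.
Proof.
move=> kN; have inv := pfrac_invP nf_normal (ltnW kN).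
by have [] := normal_index_pfrac nf_normal kN inv.
Qed.

Lemma l_atom_neq0 j : (0 < j <= N)%N -> l_atom nf c j != 0.
Proof.
case: j => // j /= jN.
by have [] := stieltjes_pfrac b_neq0 c_regular jN.
Qed.

Lemma size_mulX_m_atom j : (0 < j <= N)%N -> (1 < size ('X * m_atom nf c j)%R)%N.
Proof.
case: j => // j /= jN; have inv := pfrac_invP nf_normal (ltnW jN).
have v_gt0 : (0 < nu nf c j.+1)%N.
  by rewrite /nu subn_gt0 normal_index_ltn // ltnSn.
have [_ c0 b0] := normal_index_pfrac nf_normal jN inv.
have [d0 _ _] := stieltjes_pfrac b_neq0 c_regular jN.
have sa := size_a v_gt0 c0 b0.
rewrite mulX_m_atom size_scale // size_polyDl sa ?ltnS // size_polyN.
exact: leq_trans (size_polyC_leq1 _) v_gt0.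
Qed.

Lemma PplusE : P (2 * N).-1 = (stieltjes_pair nf c 0 1 N.*2).1 /\
  P (2 * N) = (stieltjes_pair nf c 0 1 N.*2).2.
Proof.
rewrite mul2n /Pplus; have := normal_count_gt0; case: N => // k _.
by rewrite doubleS stieltjes_pair_prev.
Qed.

Lemma QplusE : Q (2 * N).-1 = (stieltjes_pair nf c 1 0 N.*2).1 /\
  Q (2 * N) = (stieltjes_pair nf c 1 0 N.*2).2.
Proof.
rewrite mul2n /Qplus; have := normal_count_gt0; case: N => // k _.
by rewrite doubleS stieltjes_pair_prev.
Qed.

Lemma stieltjes_poly_det : P (2 * N) * Q (2 * N).-1 - P (2 * N).-1 * Q (2 * N) = 1.
Proof.
have [-> ->] := PplusE; have [-> ->] := QplusE; exact: stieltjes_det.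
Qed.

(** The last bound says that S P+_(2N) - Q+_(2N) is O(z^(-nf-1)) for the truncated
    series S = - A / z^M. *)
Lemma stieltjes_poly_size :
  [/\ size (P (2 * N)) = nf.+1, (size (P (2 * N).-1) <= nf.+1)%N &
      (size (A * P (2 * N) + 'X^M * Q (2 * N))%R <= nf)%N].
Proof.
have [-> ->] := PplusE; have [_ ->] := QplusE.
have N0 := normal_count_gt0.
have N1 : (N.-1 < N)%N by rewrite prednK.
have [_] := stieltjes_pfrac b_neq0 c_regular N1.
rewrite prednK // => l0 inv.
have [P2 P1] := inv 0 1; have [Q2 _] := inv 1 0.
have [sP sP' _ _ _] := pfrac_invP nf_normal (leqnn N).
have sr := size_pfrac_remainder (leqnn N) (pfrac_invP nf_normal (leqnn N)).
have [_ at0] := stieltjes_at0 nf c N.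
have s0 : scale_factor nf c N != 0.
  apply: contra_eq_neq at0 => s0.
  by rewrite P2 s0 scale0r horner0 eq_sym oner_neq0.
rewrite normal_index_last // in sP sP' sr.
split.
- by rewrite P2 size_scale.
- rewrite -(size_scale _ l0) P1; apply: (leq_trans (size_polyD _ _)).
  rewrite size_polyN geq_max; apply/andP; split.
    by rewrite size_scale // sP.
  by apply: (leq_trans (size_scale_leq _ _)); rewrite (leq_trans sP').
- rewrite P2 Q2 -!scalerAr -scalerDr size_scale //.
  by rewrite addnK in sr.
Qed.

End Summary.

Section Mobius.
Variables (R : realType) (nf : nat) (c : nat -> R).
Local Notation N := (normal_count nf c).

Lemma evalCD (p q : {poly R}) z : evalC (p + q) z = evalC p z + evalC q z.
Proof. by rewrite /evalC rmorphD hornerD. Qed.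
Lemma evalCB (p q : {poly R}) z : evalC (p - q) z = evalC p z - evalC q z.
Proof. by rewrite /evalC rmorphB hornerD hornerN. Qed.
Lemma evalCM (p q : {poly R}) z : evalC (p * q) z = evalC p z * evalC q z.
Proof. by rewrite /evalC rmorphM hornerM. Qed.
Lemma evalCZ k (p : {poly R}) z : evalC (k *: p) z = k%:C * evalC p z.
Proof. by rewrite /evalC map_polyZ hornerZ. Qed.
Lemma evalCXn n z : evalC ('X^n : {poly R}) z = z ^+ n.
Proof. by rewrite /evalC map_polyXn hornerXn. Qed.
Lemma evalCX z : evalC ('X : {poly R}) z = z.
Proof. by rewrite -['X]expr1 evalCXn expr1. Qed.
Lemma evalC1 z : evalC (1 : {poly R}) z = 1.
Proof. by rewrite /evalC rmorph1 hornerC. Qed.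
Lemma evalC0 z : evalC (0 : {poly R}) z = 0.
Proof. by rewrite /evalC rmorph0 horner0. Qed.

Lemma Sfrac_tailS z t j : (j < N)%N -> Sfrac_tail nf c z t j =
  1 / (- (z * evalC (m_atom nf c j.+1) z)
       + 1 / ((l_atom nf c j.+1)%:C + Sfrac_tail nf c z t j.+1)).
Proof.
move=> jN; rewrite /Sfrac_tail.
by have -> : (N - j = (N - j.+1).+1)%N by lia.
Qed.

Lemma Sfrac_tail_last z t : Sfrac_tail nf c z t N = t.
Proof. by rewrite /Sfrac_tail subnn. Qed.

Lemma mobius_step (zm l T y1 y2 : R[i]) : l + T != 0 -> - zm + 1 / (l + T) != 0 ->
  (y1 - zm * y2) * T + (y2 + l * (y1 - zm * y2)) =
  (l + T) * (- zm + 1 / (l + T)) * (y1 * (1 / (- zm + 1 / (l + T))) + y2).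
Proof.
move=> D0 E0.
have DV : (l + T) * (1 / (l + T)) = 1 by rewrite mul1r divff.
have EV : (- zm + 1 / (l + T)) * (1 / (- zm + 1 / (l + T))) = 1.
  by rewrite [X in _ * X]mul1r divff.
move: DV EV; move: (1 / (l + T)) => w DV; move: (1 / _) => e EV.
transitivity ((l + T) * y1 * ((- zm + w) * e) + ((l + T) * w - zm * (l + T)) * y2).
  by rewrite EV DV; ring.
by ring.
Qed.

(** Unfolding one level of the continued fraction multiplies numerator and
    denominator of the Moebius transformation by the same nonzero factor. *)
Lemma Sfrac_mobius_step z t : Sfrac_defined nf c z t ->
  forall j, (j <= N)%N ->
  let T := Sfrac_tail nf c z t j in
  let num := evalC (stieltjes_pair nf c 1 0 j.*2).1 z * T
             + evalC (stieltjes_pair nf c 1 0 j.*2).2 z in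
  let den := evalC (stieltjes_pair nf c 0 1 j.*2).1 z * T
             + evalC (stieltjes_pair nf c 0 1 j.*2).2 z in
  den != 0 /\ Sfrac nf c z t = num / den.
Proof.
move=> defd; elim=> [_|j IHj jN] /=.
  by rewrite /= !evalC0 !evalC1 mul0r mul1r add0r addr0 oner_neq0 divr1.
have [] := IHj (ltnW jN).
have [D0 E0] := defd j.+1 jN.
rewrite (Sfrac_tailS z t jN).
have [-> ->] := stieltjes_pair_double nf c 1 0 j.
have [-> _] := stieltjes_pair_double nf c 1 0 j.
have [-> ->] := stieltjes_pair_double nf c 0 1 j.
have [-> _] := stieltjes_pair_double nf c 0 1 j.
rewrite !(evalCB, evalCD, evalCM, evalCZ, evalCX).
rewrite !(mobius_step _ _ D0 E0) => den0 ->; split.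
  exact: mulf_neq0 (mulf_neq0 D0 E0) den0.
by rewrite -mulf_div (divff (mulf_neq0 D0 E0)) [RHS]mul1r.
Qed.

End Mobius.

(** * Limits at infinity of rational expressions *)

Section Limits.
(** Limits along a filter on which the variable is eventually nonzero and its
    inverse tends to zero. *)
Variables (K : numFieldType) (F : set_system K).
Context {FF : Filter F}.
Hypothesis inv_cvg0 : (fun z : K => z^-1) @ F --> (0 : K).
Hypothesis near_neq0 : \forall z \near F, z != 0.

Lemma cvg_exprVn n : (0 < n)%N -> (fun z : K => (z ^+ n)^-1) @ F --> (0 : K).
Proof.
case: n => // n _.
elim: n => [|n IHn]; first by under eq_fun do rewrite expr1.
under eq_fun do rewrite exprS invfM.
have lim := cvgM inv_cvg0 IHn; rewrite mul0r in lim; exact: lim.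
Qed.

Lemma cvg_poly_leading (p : {poly K}) n : (size p <= n.+1)%N ->
  (fun z : K => p.[z] / z ^+ n) @ F --> (p`_n : K).
Proof.
elim: n p => [|n IHn] p sp.
  rewrite [p]size1_polyC // coefC /=.
  under eq_fun do rewrite hornerC expr0 divr1.
  exact: cvg_cst.
pose q := drop_poly 1 p.
have pE z : p.[z] = p`_0 + q.[z] * z.
  rewrite -{1}[p](poly_take_drop 1) hornerD expr1 hornerMX; congr (_ + _).
  rewrite [take_poly 1 p]size1_polyC ?size_take_poly // hornerC.
  by rewrite coef_take_poly.
have q_cvg : (fun z : K => q.[z] / z ^+ n) @ F --> (q`_n : K).
  by apply: IHn; rewrite size_drop_poly; lia.
have -> : p`_n.+1 = p`_0 * 0 + q`_n by rewrite mulr0 add0r coef_drop_poly addn1.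
have lim : (fun z : K => p`_0 * (z ^+ n.+1)^-1 + q.[z] / z ^+ n) @ F
    --> (p`_0 * 0 + q`_n : K).
  by apply: cvgD => //; apply: cvgM; [exact: cvg_cst|exact: cvg_exprVn].
apply: cvg_trans lim; apply: near_eq_cvg.
near=> z.
have z0 : z != 0 by near: z.
by rewrite /= pE mulrDl; congr (_ + _); rewrite exprS invfM mulrA mulfK.
Unshelve. all: by end_near.
Qed.

(** If [g] is o(z^(-2n)) then g p - r / z^(2n) is o(z^(-n)) as soon as [p] has degree
    at most [n] and [r] has degree less than [n]. *)
Lemma cvg_remainder (g : K -> K) (p r : {poly K}) n :
  (fun z : K => g z * z ^+ (n + n)) @ F --> (0 : K) ->
  (size p <= n.+1)%N -> (size r <= n)%N ->
  (fun z : K => (g z * p.[z] - r.[z] / z ^+ (n + n)) * z ^+ n) @ F --> (0 : K).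
Proof.
move=> g0 sp sr.
have lim : (fun z : K => g z * z ^+ (n + n) * (p.[z] / z ^+ n) - r.[z] / z ^+ n) @ F
    --> (0 * p`_n - r`_n : K).
  apply: cvgB; first by apply: cvgM => //; exact: cvg_poly_leading.
  by apply: cvg_poly_leading; exact: leqW.
rewrite mul0r [r`_n]nth_default // subr0 in lim.
apply: cvg_trans lim; apply: near_eq_cvg; apply: filterS near_neq0 => z z0.
rewrite exprD; have : z ^+ n != 0 by rewrite expf_neq0.
by move: (z ^+ n) (g z) p.[z] r.[z] => w x y u w0; field.
Qed.

(** The parameter obtained by inverting the Moebius transformation tends to zero:
    the determinant relation forces p2 (f p1 - q1) to tend to -1, whereas
    p2 (f p2 - q2) tends to 0. *)
Lemma cvg_mobius_param (f : K -> K) (p1 p2 q1 q2 : {poly K}) n :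
  (fun z : K => (f z * p2.[z] - q2.[z]) * z ^+ n) @ F --> (0 : K) ->
  size p2 = n.+1 -> (size p1 <= n.+1)%N -> p2 * q1 - p1 * q2 = 1 ->
  (\forall z \near F, f z * p1.[z] - q1.[z] != 0) /\
  (fun z : K => (q2.[z] - f z * p2.[z]) / (f z * p1.[z] - q1.[z])) @ F --> (0 : K).
Proof.
move=> rem sp2 sp1 pq.
have sp2' : (size p2 <= n.+1)%N by rewrite sp2.
have rem2 (p : {poly K}) : (size p <= n.+1)%N ->
    (fun z : K => p.[z] * (f z * p2.[z] - q2.[z])) @ F --> (0 : K).
  move=> sp; have lim : (fun z : K => p.[z] / z ^+ n *
      ((f z * p2.[z] - q2.[z]) * z ^+ n)) @ F --> (p`_n * 0 : K).
    by apply: cvgM => //; exact: cvg_poly_leading.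
  rewrite mulr0 in lim; apply: cvg_trans lim; apply: near_eq_cvg.
  near=> z; have z0 : z != 0 by near: z.
  by rewrite /= [(_ - _) * _]mulrC mulrA divfK ?expf_neq0.
have den_cvg : (fun z : K => p2.[z] * (f z * p1.[z] - q1.[z])) @ F --> (- 1 : K).
  have lim : (fun z : K => p1.[z] * (f z * p2.[z] - q2.[z]) - 1) @ F --> (0 - 1 : K).
    by apply: cvgB; [exact: rem2|exact: cvg_cst].
  rewrite sub0r in lim; rewrite (_ : (fun z => _) =
    (fun z : K => p1.[z] * (f z * p2.[z] - q2.[z]) - 1)) //.
  apply/funext => z.
  have := congr1 (horner^~ z) pq; rewrite !hornerE => <-; ring.
have den_neq0 : \forall z \near F, p2.[z] * (f z * p1.[z] - q1.[z]) != 0.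
  by apply: (cvgr_neq0 _ den_cvg); rewrite oppr_eq0 oner_neq0.
split.
  by apply: filterS den_neq0 => z; rewrite mulf_eq0 negb_or => /andP[].
have lim : (fun z : K => - (p2.[z] * (f z * p2.[z] - q2.[z])) *
    (p2.[z] * (f z * p1.[z] - q1.[z]))^-1) @ F --> (- 0 * (-1)^-1 : K).
  apply: cvgM; first by apply: cvgN; exact: rem2.
  by apply: cvgV => //; rewrite oppr_eq0 oner_neq0.
rewrite oppr0 mul0r in lim; apply: cvg_trans lim; apply: near_eq_cvg.
apply: filterS den_neq0 => z; rewrite mulf_eq0 negb_or => /andP[p20 d0].
by rewrite -mulrN opprB -mulf_div divff // mul1r.
Unshelve. all: by end_near.
Qed.

(** One level of the continued fraction keeps tails that tend to zero, since [m] is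
    not constant and hence unbounded at infinity. *)
Lemma cvg_Sfrac_tail (T : K -> K) (l : K) (m : {poly K}) :
  T @ F --> (0 : K) -> l != 0 -> (1 < size m)%N ->
  [/\ \forall z \near F, l + T z != 0,
      \forall z \near F, - m.[z] + 1 / (l + T z) != 0 &
      (fun z : K => 1 / (- m.[z] + 1 / (l + T z))) @ F --> (0 : K)].
Proof.
move=> T0 l0 sm; set n := (size m).-1.
have n_gt0 : (0 < n)%N by rewrite /n; lia.
have D_cvg : (fun z => l + T z) @ F --> (l : K).
  have lim : (fun z => l + T z) @ F --> (l + 0 : K).
    by apply: cvgD => //; exact: cvg_cst.
  by rewrite addr0 in lim.
(* After division by the leading power of m the denominator has a nonzero limit. *)
have E_cvg : (fun z => - (m.[z] / z ^+ n) + (l + T z)^-1 * (z ^+ n)^-1) @ F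
    --> (- m`_n : K).
  have -> : - m`_n = - m`_n + l^-1 * 0 by rewrite mulr0 addr0.
  apply: cvgD.
    by apply: cvgN; apply: cvg_poly_leading; rewrite /n; lia.
  by apply: cvgM; [exact: cvgV|exact: cvg_exprVn].
have m0 : - m`_n != 0.
  by rewrite oppr_eq0 -/(lead_coef m) lead_coef_eq0 -size_poly_gt0; lia.
have E_neq0 : \forall z \near F,
    - (m.[z] / z ^+ n) + (l + T z)^-1 * (z ^+ n)^-1 != 0.
  exact: (cvgr_neq0 _ E_cvg m0).
have EE z : - (m.[z] / z ^+ n) + (l + T z)^-1 * (z ^+ n)^-1 =
    (- m.[z] + 1 / (l + T z)) * (z ^+ n)^-1 by rewrite mul1r mulrDl mulNr.
split; first exact: (cvgr_neq0 _ D_cvg l0).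
  by apply: filterS E_neq0 => z; rewrite EE mulf_eq0 negb_or => /andP[].
have lim : (fun z => (z ^+ n)^-1 *
    (- (m.[z] / z ^+ n) + (l + T z)^-1 * (z ^+ n)^-1)^-1) @ F
    --> (0 * (- m`_n)^-1 : K).
  by apply: cvgM; [exact: cvg_exprVn|exact: cvgV].
rewrite mul0r in lim; apply: cvg_trans lim; apply: near_eq_cvg.
apply: filterS E_neq0 => z; rewrite EE mulf_eq0 negb_or => /andP[E0 z0].
by rewrite /= invfM mulrCA divff // mulr1 [RHS]div1r.
Qed.

End Limits.

(** * Nontangential limits in Stolz domains *)

(** Stolz domains lie in the open upper half-plane, where a solution of the moment
    problem is a sum over multi-indices. *)
Lemma stolz_near_Im_gt0 (R : realType) (theta : R) : stolz_angle theta ->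
  stolz_infty theta (fun z => 0 < complex.Im z).
Proof.
move=> /andP[th0 _]; exists 0 => z [r [phi [r0 /andP[th_phi phi_th] ->]]] _ /=.
rewrite mulr_gt0 // sin_gt0_pi // (lt_trans th0 th_phi) /=.
by rewrite (lt_le_trans phi_th) // gerBl ltW.
Qed.

Section StolzLimits.
Variables (R : realType) (theta : R).
Let C : numFieldType := R[i].
Local Notation F := (stolz_infty theta).

Lemma gt0_complexE (e : R[i]) : 0 < e -> 0 < complex.Re e /\ e = (complex.Re e)%:C.
Proof. by case: e => x y; rewrite ltcE /= => /andP[/eqP -> ->]. Qed.

Lemma stolz_near_neq0 : F (fun z : C => z != 0).
Proof. by exists 0 => z _; rewrite normr_gt0. Qed.

Lemma stolz_inv_cvg0 : (fun z : C => z^-1) @ F --> (0 : C).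
Proof.
apply: (proj2 (@cvgr0Pnorm_le C C C F _ (fun z : C => z^-1))) => e e0.
have [re0 eE] := gt0_complexE e0.
exists (complex.Re e)^-1 => z _ lt_z.
rewrite normfV eE -[X in _ <= X]invrK lef_pV2 ?posrE.
- by rewrite ltW // -fmorphV.
- apply: lt_trans lt_z; by rewrite ltcR invr_gt0.
- by rewrite invr_gt0 ltcR.
Qed.

Lemma stolz_littleo_cvg0 (f : R[i] -> R[i]) n :
  stolz_angle theta -> stolz_littleo f (fun z => 1 / z ^+ n) ->
  (fun z : C => f z * z ^+ n) @ F --> (0 : C).
Proof.
move=> th /(_ theta th)/eqoP fo.
apply: (proj2 (@cvgr0Pnorm_le C C C F _ _)) => e e0.
have near_neq0 : \forall z \near F, z != 0 by exact: stolz_near_neq0.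
apply: filterS2 near_neq0 (fo e e0) => z z0.
rewrite div1r normfV => fz; rewrite normrM.
by rewrite -ler_pdivlMr // normr_gt0 expf_neq0.
Qed.

Lemma cvg0_littleo1 (f : R[i] -> R[i]) : (fun z : C => f z) @ F --> (0 : C) ->
  (f : R[i] -> R[i]^o) =o_F ((fun=> 1) : R[i] -> R[i]^o).
Proof.
move=> f0; apply/eqoP => e e0.
have fe := proj1 (@cvgr0Pnorm_le C C C F (stolz_infty_filter theta) f) f0 e e0.
by apply: filterS fe => z fz; rewrite normr1 mulr1.
Qed.

End StolzLimits.

(** * The representation for one sequence *)

Section SequenceProblem.
Variables (R : realType) (nf : nat) (c : nat -> R).
Hypotheses (nf_normal : nf \in normal_indices nf c) (c_regular : regular nf c).
Variable f : R[i] -> R[i].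
Hypothesis f_asymp : stolz_littleo
  (fun z => f z - (- \sum_(i < nf + nf) (c i)%:C / z ^+ i.+1))
  (fun z => 1 / z ^+ (nf + nf)).
Let C : numFieldType := R[i].
Local Notation N := (normal_count nf c).
Local Notation M := (nf + nf)%N.
Local Notation A := (moment_poly M c).
Local Notation P := (Pplus nf c).
Local Notation Q := (Qplus nf c).
Local Notation toC p := (map_poly (real_complex R) p : {poly C}).

(** The only candidate for the parameter: the value of t for which the Moebius
    transformation takes the value [f z]. *)
Definition mobius_param (z : R[i]) : R[i] :=
  (evalC (Q (2 * N)) z - f z * evalC (P (2 * N)) z)
  / (f z * evalC (P (2 * N).-1) z - evalC (Q (2 * N).-1) z).

(** The prescribed asymptotic part of [f] is - A / z^M. *)
Lemma moment_sumE L (z : R[i]) : z != 0 ->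
  \sum_(i < L) (c i)%:C / z ^+ i.+1 = evalC (moment_poly L c) z / z ^+ L.
Proof.
move=> z0; rewrite /evalC (@horner_coef_wide _ L); last first.
  by rewrite size_map_poly size_moment_poly.
rewrite mulr_suml [RHS](reindex_inj rev_ord_inj); apply: eq_bigr => i _ /=.
rewrite coef_map /= coef_moment_poly // -mulrA; congr (_ * _).
have -> : z ^+ L = z ^+ (L - i.+1) * z ^+ i.+1 by rewrite -exprD subnK.
by rewrite invfM mulrA divff ?mul1r // expf_neq0.
Qed.

Lemma mobius_param_cvg theta : stolz_angle theta ->
  (\forall z \near stolz_infty theta,
     f z * evalC (P (2 * N).-1) z - evalC (Q (2 * N).-1) z != 0) /\
  (fun z : C => mobius_param z) @ stolz_infty theta --> (0 : C).
Proof.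
move=> th; have [sP sP' sr] := stieltjes_poly_size nf_normal c_regular.
have FF : Filter (stolz_infty theta : set_system C) := stolz_infty_filter theta.
have inv0 := @stolz_inv_cvg0 R theta.
have near0 : \forall z \near stolz_infty theta, z != 0 by exact: stolz_near_neq0.
apply: (@cvg_mobius_param C (stolz_infty theta) _ inv0 near0 f
  (toC (P (2 * N).-1)) (toC (P (2 * N))) (toC (Q (2 * N).-1)) (toC (Q (2 * N))) nf).
- set r : {poly R} := A * P (2 * N) + 'X^M * Q (2 * N).
  have lim := @cvg_remainder C (stolz_infty theta) FF inv0 near0
    (fun z => f z - (- \sum_(i < M) (c i)%:C / z ^+ i.+1)) (toC (P (2 * N))) (toC r) nf
    (stolz_littleo_cvg0 th f_asymp).
  rewrite !size_map_poly sP in lim; move: (lim (leqnn _) sr) => {}lim.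
  apply: cvg_trans lim; apply: near_eq_cvg.
  apply: filterS near0 => z z0 /=.
  rewrite (moment_sumE _ z0) opprK.
  have -> : (toC r).[z] = evalC A z * evalC (P (2 * N)) z + z ^+ M * evalC (Q (2 * N)) z.
    by rewrite -[LHS]/(evalC r z) evalCD !evalCM evalCXn.
  rewrite -/(evalC (P (2 * N)) z) -/(evalC (Q (2 * N)) z).
  have : z ^+ M != 0 by rewrite expf_neq0.
  move: (z ^+ M) (z ^+ nf) (evalC A z) => w x A' w0.
  congr (_ * _); rewrite [(_ + w * _) / w]mulrDl [w * _ / w]mulrAC divff // mul1r; ring.
- by rewrite size_map_poly.
- by rewrite size_map_poly.
- by rewrite -!rmorphM -rmorphB /= stieltjes_poly_det // rmorph1.
Qed.

Lemma mobius_param_eq z :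
  f z * evalC (P (2 * N).-1) z - evalC (Q (2 * N).-1) z != 0 ->
  mobius_den nf c z (mobius_param z) != 0 ->
  f z = mobius_num nf c z (mobius_param z) / mobius_den nf c z (mobius_param z).
Proof.
move=> d0 den0; apply: (canRL (mulfK den0)).
have : mobius_param z * (f z * evalC (P (2 * N).-1) z - evalC (Q (2 * N).-1) z) =
  evalC (Q (2 * N)) z - f z * evalC (P (2 * N)) z by rewrite divfK.
rewrite /mobius_den /mobius_num; move: (mobius_param z) => t tE.
apply/eqP; rewrite -subr_eq0; apply/eqP.
transitivity (t * (f z * evalC (P (2 * N).-1) z - evalC (Q (2 * N).-1) z)
  - (evalC (Q (2 * N)) z - f z * evalC (P (2 * N)) z)); first by ring.
by rewrite tE subrr.
Qed.

(** All tails of the continued fraction tend to zero, and its denominators are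
    eventually nonzero, by descending induction from the innermost tail, which is the
    parameter itself. *)
Lemma Sfrac_tail_cvg theta j : stolz_angle theta -> (j <= N)%N ->
  (fun z : C => Sfrac_tail nf c z (mobius_param z) j) @ stolz_infty theta --> (0 : C) /\
  ((0 < j)%N -> \forall z \near stolz_infty theta,
     (l_atom nf c j)%:C + Sfrac_tail nf c z (mobius_param z) j != 0 /\
     - (z * evalC (m_atom nf c j) z)
     + 1 / ((l_atom nf c j)%:C + Sfrac_tail nf c z (mobius_param z) j) != 0).
Proof.
move=> th.
have FF : Filter (stolz_infty theta : set_system C) := stolz_infty_filter theta.
have inv0 := @stolz_inv_cvg0 R theta.
have near0 : \forall z \near stolz_infty theta, z != 0 by exact: stolz_near_neq0.
have step k : (0 < k <= N)%N ->
  (fun z : C => Sfrac_tail nf c z (mobius_param z) k) @ stolz_infty theta --> (0 : C) ->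
  (\forall z \near stolz_infty theta,
     (l_atom nf c k)%:C + Sfrac_tail nf c z (mobius_param z) k != 0 /\
     - (z * evalC (m_atom nf c k) z)
     + 1 / ((l_atom nf c k)%:C + Sfrac_tail nf c z (mobius_param z) k) != 0) /\
  (fun z : C => Sfrac_tail nf c z (mobius_param z) k.-1) @ stolz_infty theta --> (0 : C).
  move=> kN T0.
  have zm z : z * evalC (m_atom nf c k) z = (toC ('X * m_atom nf c k)).[z].
    by rewrite -/(evalC _ z) evalCM evalCX.
  have [||D0 E0 T1] := @cvg_Sfrac_tail C (stolz_infty theta) _ inv0 near0 _
    (l_atom nf c k)%:C (toC ('X * m_atom nf c k)) T0.
  - by rewrite fmorph_eq0 (l_atom_neq0 nf_normal).
  - by rewrite size_map_poly (size_mulX_m_atom nf_normal).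
  split.
    by apply: filterS2 D0 E0 => z D0 E0; rewrite zm.
  apply: cvg_trans T1; apply: near_eq_cvg; apply: filterE => z.
  case: k kN {T0 D0 E0} zm => // k kN zm /=.
  by rewrite [RHS]Sfrac_tailS // zm.
move: j.
suff tail k : (k <= N)%N ->
    (fun z : C => Sfrac_tail nf c z (mobius_param z) (N - k)) @ stolz_infty theta
      --> (0 : C).
  move=> j jN; have := tail (N - j)%N (leq_subr _ _); rewrite subKn // => Tj.
  by split=> // j0; have [] := step j _ Tj; rewrite ?j0.
elim: k => [_|k IHk kN].
  rewrite subn0.
  have -> : (fun z : C => Sfrac_tail nf c z (mobius_param z) N) = mobius_param.
    by apply/funext => z; rewrite Sfrac_tail_last.
  by have [] := mobius_param_cvg th.
have kN' : (0 < N - k <= N)%N by rewrite subn_gt0 kN leq_subr.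
by have [_] := step _ kN' (IHk (ltnW kN)); rewrite subnS.
Qed.

Lemma Sfrac_representation theta : stolz_angle theta ->
  \forall z \near stolz_infty theta,
    [/\ Sfrac_defined nf c z (mobius_param z),
        f z = Sfrac nf c z (mobius_param z),
        mobius_den nf c z (mobius_param z) != 0 &
        f z = mobius_num nf c z (mobius_param z) / mobius_den nf c z (mobius_param z)].
Proof.
move=> th; have [den_near _] := mobius_param_cvg th.
have defd : \forall z \near stolz_infty theta, Sfrac_defined nf c z (mobius_param z).
  have allj : \forall z \near stolz_infty theta, forall j : 'I_N.+1, (0 < j)%N ->
     (l_atom nf c j)%:C + Sfrac_tail nf c z (mobius_param z) j != 0 /\
     - (z * evalC (m_atom nf c j) z)
     + 1 / ((l_atom nf c j)%:C + Sfrac_tail nf c z (mobius_param z) j) != 0.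
    apply: filter_forall => j; have [_ near_j] := Sfrac_tail_cvg th (leq_ord j).
    have [j0|] := ltnP 0 j; last by rewrite leqn0 => /eqP ->; exact: filterE.
    by apply: filterS (near_j j0).
  apply: filterS allj => z allj j /andP[j0 jN].
  exact: (allj (Ordinal (jN : (j < N.+1)%N)) j0).
apply: filterS2 den_near defd => z den0 dz.
have [mden0 SE] := Sfrac_mobius_step dz (leqnn N).
have [P1 P2] := PplusE nf_normal; have [Q1 Q2] := QplusE nf_normal.
rewrite Sfrac_tail_last -P1 -P2 -Q1 -Q2 in mden0 SE.
by split=> //; rewrite ?SE; exact: mobius_param_eq.
Qed.

End SequenceProblem.

(** * Solutions of the moment problem *)

Theorem theorem4p4 (R : realType) (n nf : nat)
    (hn : (2 <= n)%N) (hnf : (1 <= nf)%N)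
    (s : 'I_(2 * nf).-1.+1 -> multi_index n (2 * nf).-1 -> R)
    (s_normal : forall J : multi_index n (2 * nf).-1,
        nf \in normal_indices nf (associated_seq s J))
    (s_regular : forall J : multi_index n (2 * nf).-1,
        regular nf (associated_seq s J))
    (F : R[i] -> {ffun 'I_n.-1 -> R[i]} -> R[i])
    (hF : MP_solution s F) :
  exists tau : multi_index n (2 * nf).-1 -> R[i] -> R[i],
    (forall J, stolz_littleo (tau J) (fun=> 1)) /\
    (forall theta : R, stolz_angle theta ->
       \forall z1 \near stolz_infty theta,
       forall z' : {ffun 'I_n.-1 -> R[i]}, (forall k, z' k != 0) ->
       [/\ forall J, Sfrac_defined nf (associated_seq s J) z1 (tau J z1),
           F z1 z' = \sum_(J : multi_index n (2 * nf).-1)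
             1 / monomial J z' * Sfrac nf (associated_seq s J) z1 (tau J z1),
           forall J, mobius_den nf (associated_seq s J) z1 (tau J z1) != 0 &
           F z1 z' = \sum_(J : multi_index n (2 * nf).-1)
             1 / monomial J z' *
             (mobius_num nf (associated_seq s J) z1 (tau J z1)
              / mobius_den nf (associated_seq s J) z1 (tau J z1))]).
Proof.
case: hF => f [fE f_asymp].
have LE : (2 * nf).-1.+1 = (nf + nf)%N by rewrite prednK ?muln_gt0 // mul2n addnn.
have asymp J : stolz_littleo
    (fun z => f J z - (- \sum_(i < nf + nf) (associated_seq s J i)%:C / z ^+ i.+1))
    (fun z => 1 / z ^+ (nf + nf)).
  by have := f_asymp J; rewrite LE.
exists (fun J => mobius_param nf (associated_seq s J) (f J)); split.
  move=> J theta th; apply: cvg0_littleo1.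
  by have [] := mobius_param_cvg (s_normal J) (s_regular J) (asymp J) th.
move=> theta th.
have repr : \forall z \near stolz_infty theta, forall J,
    let c := associated_seq s J in let t := mobius_param nf c (f J) z in
    [/\ Sfrac_defined nf c z t, f J z = Sfrac nf c z t, mobius_den nf c z t != 0 &
        f J z = mobius_num nf c z t / mobius_den nf c z t].
  apply: filter_forall => J.
  exact: (Sfrac_representation (s_normal J) (s_regular J) (asymp J) th).
have im : \forall z \near stolz_infty theta, 0 < complex.Im z.
  exact: stolz_near_Im_gt0.
apply: filterS2 im repr => z im repr z' z'0.
split.
- by move=> J; have [] := repr J.
- rewrite fE //; apply: eq_bigr => J _; have [_ fJ _ _] := repr J.
  by rewrite {1}fJ mulrC div1r.
- by move=> J; have [] := repr J.
- rewrite fE //; apply: eq_bigr => J _; have [_ _ _ fJ] := repr J.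
  by rewrite {1}fJ mulrC div1r.
Qed.
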